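(* Let $f:[0,1]\setminus\{c\}\to[0,1]$ be a $C^2$ non-flat contracting Lorenz map without periodic attractors and let $\Lambda$ be its single topological attractor (the transitive topological attractor whose basin is residual in $[0,1]$, as described in the context). Then $f$ has no wandering interval if and only if $\alpha_f(x)=[0,1]$ for all $x\in\Lambda$.
   Context: Lorenz maps. A Lorenz map is a $C^2$ map $f:[0,1]\setminus\{c\}\to[0,1]$, $0<c<1$, with $f(0)=0$, $f(1)=1$ and $f'(x)>0$ for all $x\in[0,1]\setminus\{c\}$. It is contracting if $\lim_{x\to c}f'(x)=0$ and there is no open interval $I$ and $n\ge1$ with $f^n|_I\equiv\mathrm{id}$. A contracting Lorenz map is non-flat if there are $\alpha,\beta>1$, $a,b\in[0,1]$ and $C^2$ orientation preserving diffeomorphisms $\phi_0:[0,c]\to[0,a^{1/\alpha}]$, $\phi_1:[c,1]\to[0,b^{1/\beta}]$ with $f(x)=a-(\phi_0(c-x))^\alpha$ for $x<c$ and $f(x)=1-b+(\phi_1(x))^\beta$ for $x>c$. Orbits. $f^n(c_\pm)=\lim_{\epsilon\downarrow0}f^n(c\pm\epsilon)$. If $x\in\{f(c_-),f(c_+)\}$ put $f^{-1}(x)=\{c\}\cup\{y: f(y)=x\}$, $f^{-1}(X)=\bigcup_{x\in X}f^{-1}(x)$, and $f^{-n}$ is defined inductively; $\mathcal O_f^-(x)=\bigcup_{n\ge0}f^{-n}(x)$ with $f^0(x)=x$. For $x\notin\mathcal O_f^-(c)$, $\mathcal O_f^+(x)=\{f^j(x):j\ge0\}$. If $f^p(c_-)=c$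 for some $p\ge1$, take $p$ minimal and set $\mathcal O_f^+(c_-)=\{f^j(c_-):1\le j\le p\}$; otherwise $\mathcal O_f^+(c_-)=\{f^j(c_-):j\ge0\}$; similarly for $c_+$. For $x\in\mathcal O_f^-(c)$, $\mathcal O_f^+(x)=\{x,f(x),\dots,f^{m-1}(x),c\}\cup\mathcal O_f^+(c_-)\cup\mathcal O_f^+(c_+)$, $m$ minimal with $f^m(x)=c$. $\omega_f(x)$ is the set of accumulation points of the positive orbit of $x$, for $x\in[0,c)\cup\{c_-,c_+\}\cup(c,1]$ (in the usual sense of limits along times tending to infinity). $\alpha_f(x)$ is the set of points $y=\lim_j x_j$ for some sequence $x_j\in f^{-n_j}(x)$ with $n_j\to+\infty$. Attractors. For a set $A$, $\beta(A)=\{x:\omega_f(x)\subset A\}$. A compact set $A$ is a topological attractor if $\beta(A)$ is residual in an open set and, for each closed forward invariant $A'\subsetneq A$, $\beta(A)\setminus\beta(A')$ is residual in an open set. The orbit of a periodic point $p$ is an attracting periodic orbit if for some $\epsilon>0$, $(p,p+\epsilon)$ or $(p-\epsilon,p)$ is contained in $\beta(\mathcal O_f^+(p))$. A periodic attractor is a finite set $\Lambda$ such that $\{x:\omega_f(x)=\Lambda\}$ has non-empty interior; it is either an attracting periodic orbit or a super-attractor, i.e. a finite set $\{p_1,\dots,p_n,c\}$ with $f(p_i)=p_{i+1}$ for $1\le i<n$, $f(p_n)=c$, and $f(c_+)=p_1$ or $f(c_-)=p_1$. A wandering interval is an interval $I$ such that $f^n|_I$ is a homeomorphism for all $n\ge1$,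 $f^i(I)\cap f^j(I)=\emptyset$ for $i\ne j>0$, and $I$ does not intersect the basin of an attracting periodic orbit. The attractor $\Lambda$. For a $C^2$ non-flat contracting Lorenz map $f$ without periodic attractors it is known that there is a transitive topological attractor $\Lambda$ such that $\beta(\Lambda)$ is residual in $[0,1]$ and $\Lambda$ is of one and only one of these types: (1) a Cherry attractor, with $\omega_f(x)=\Lambda$ for an open and dense set of $x\in[0,1]$; (2) a solenoidal attractor, with $\omega_f(x)=\Lambda$ for a residual set of $x\in[0,1]$; (3) a chaotic attractor which is either (a) a cycle of intervals, with $\omega_f(x)=\Lambda$ for a residual set of $x\in[0,1]$, or (b) a Cantor set, in which case there are wandering intervals. The claim refers to this $\Lambda$. The terms used are the following. An attractor $\Lambda$ is chaotic if it is transitive, $\overline{\mathrm{Per}(f)\cap\Lambda}=\Lambda$, its topological entropy $h_{top}(f|_\Lambda)$ is positive, and there are $\lambda>0$ and a dense subset of points $x\in\Lambda$ with $\liminf_n\frac1n\log|Df^n(x)|>\lambda$. A cycle of intervals is a transitive finite union of non-trivial disjoint closed intervals. The first return map to an interval $T$ is $x\mapsto f^{R(x)}(x)$, $R(x)=\min\{j\ge1:f^j(x)\in T\}$, on the points of $T$ that return to $T$. A gap map is a continuous injective map $g:S^1\setminus\{c\}\to S^1$, $S^1=\mathbb R/\mathbb Z$. $f$ is a Cherry map if there is a neighborhood $J$ of $c$ such that the first return map to $J$ is conjugated to a gap map with irrational rotation number (equivalently, $f$ has no super-attractor and $c\in\omega_f(x_\pm)$ for all $x$ in some neighborhood of $c$);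 its Cherry attractor is $\Lambda=\omega_f(c_-)=\omega_f(c_+)$. A renormalization interval is an open interval $J=(a,b)\ni c$ such that the first return map to $[a,b]$ is conjugated to a Lorenz map (then $a,b$ are periodic); its renormalization cycle is $U_J=\bigcup_{i=0}^{\mathrm{period}(a)}f^i((a,c))\cup\bigcup_{i=0}^{\mathrm{period}(b)}f^i((c,b))$; with $\Lambda_J=\{x:\mathcal O_f^+(x)\cap J=\emptyset\}$, $K_J$ is the union of those connected components of $[0,1]\setminus\Lambda_J$ each containing one of the intervals of the cycle. A solenoidal attractor is an attractor $\Lambda\subset\bigcap_{n}K_{J_n}$ for an infinite nested chain $\{J_n\}$ of renormalization intervals. *)

(* Defs.v *)
From mathcomp Require Import all_boot all_order all_algebra.
From mathcomp Require Import all_classical all_reals all_analysis.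

Set Implicit Arguments.
Unset Strict Implicit.
Unset Printing Implicit Defensive.

Import Order.TTheory GRing.Theory Num.Theory.
Import numFieldNormedType.Exports.

Local Open Scope classical_set_scope.
Local Open Scope ring_scope.

(* Derivatives relative to a domain A: at an endpoint of A contained in A they
   are the one-sided ones. *)
Section calculus.
Context {R : realType}.
Implicit Types (A : set R) (g : R -> R).

Definition diffq g (x y : R) : R := (g y - g x) / (y - x).

Definition derivable_within A g (x : R) : Prop :=
  cvg (diffq g x y @[y --> within A x^']).

Definition derive_within A g (x : R) : R :=
  lim (diffq g x y @[y --> within A x^']).

Definition C2_on A g : Prop :=
  [/\ forall x, A x -> derivable_within A g x,
      forall x, A x -> derivable_within A (derive_within A g) x
    & {within A, continuous (derive_within A (derive_within A g))}].

Definition C2_diffeo_op A B g : Prop :=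
  [/\ C2_on A g,
      exists h : R -> R,
        [/\ C2_on B h, set_fun A B g, set_fun B A h,
            forall x, A x -> h (g x) = x & forall y, B y -> g (h y) = y]
    & forall x y, A x -> A y -> x < y -> g x < g y].

(* [B] is residual in [U]; [U] carries the topology induced by [R]. *)
Definition residual_in (U B : set R) : Prop :=
  exists G : nat -> set R,
    (forall k, open (G k) /\ U `<=` closure (U `&` G k)) /\
    U `&` \bigcap_k G k `<=` B.

Definition residual_in_open (B : set R) : Prop :=
  exists U : set R,
    [/\ open U, U !=set0, U `<=` `[0, 1] & residual_in U B].

End calculus.

(* A map of [0,1] \ {c} is encoded by a total function f : R -> R.  None of the
   notions below depends on the values of f at c or outside [0,1]: an iterate
   [iter n f x] is only used if x, ..., f^(n-1)(x) differ from c, or inside a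
   one-sided limit at c. *)
Section lorenz.
Context {R : realType}.
Variables (c : R) (f : R -> R).
Implicit Types (A I : set R) (x y p : R) (n : nat).

Definition dom : set R := `[0, 1] `\ c.

Definition lorenz_map : Prop :=
  [/\ 0 < c < 1, set_fun dom `[0, 1] f, C2_on dom f,
      f 0 = 0 /\ f 1 = 1
    & forall x, dom x -> 0 < derive_within dom f x].

Definition iter_defined n x : Prop :=
  `[0, 1]%classic x /\ forall j, (j < n)%N -> iter j f x <> c.

Definition contracting : Prop :=
  derive_within dom f x @[x --> c^'] --> (0 : R) /\
  ~ exists a b n, [/\ a < b, (0 < n)%N &
      forall x, a < x < b -> iter_defined n x /\ iter n f x = x].

Definition non_flat : Prop :=
  exists alpha beta a b : R, exists phi0 phi1 : R -> R,
    [/\ 1 < alpha /\ 1 < beta,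
        `[0, 1]%classic a /\ `[0, 1]%classic b,
        C2_diffeo_op `[0, c] `[0, a `^ alpha^-1] phi0 /\
        C2_diffeo_op `[c, 1] `[0, b `^ beta^-1] phi1,
        forall x, 0 <= x < c -> f x = a - phi0 (c - x) `^ alpha
      & forall x, c < x <= 1 -> f x = 1 - b + phi1 x `^ beta].

(* f^n(c-) and f^n(c+) *)
Definition iter_cm n : R := lim (iter n f x @[x --> c^'-]).
Definition iter_cp n : R := lim (iter n f x @[x --> c^'+]).

Definition preim A : set R :=
  [set y | dom y /\ A (f y)] `|`
  [set y | y = c /\ (A (iter_cm 1) \/ A (iter_cp 1))].

Definition npreim n x : set R := iter n preim [set x].

Definition neg_orbit x : set R := \bigcup_n npreim n x.

(* For u = iter_cm: if p >= 1 is minimal with u p = c, this is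
   {u 1, ..., u p} (recall u 0 = c); if there is none, it is {u j : j >= 0}. *)
Definition lateral_orbit (u : nat -> R) : set R :=
  [set u j | j in [set j | forall i, (0 < i < j)%N -> u i <> c]].

(* The first part is {f^j(x) : j >= 0} if the orbit of x never meets c, and
   {x, ..., f^(m-1)(x), c} if m is minimal with f^m(x) = c. *)
Definition pos_orbit x : set R :=
  [set iter j f x | j in [set j | forall i, (i < j)%N -> iter i f x <> c]] `|`
  [set y | neg_orbit c x /\
           (lateral_orbit iter_cm y \/ lateral_orbit iter_cp y)].

(* Accumulation points of a sequence as time tends to infinity.  If
   f^p(c-) = c, then [iter_cm] is periodic and its accumulation points are
   those of its cycle; likewise at c+. *)
Definition omega_seq (u : nat -> R) : set R := cluster (u @ \oo).

Definition omega x : set R :=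
  [set y | (~ neg_orbit c x /\ omega_seq (fun n => iter n f x) y) \/
           (neg_orbit c x /\ (omega_seq iter_cm y \/ omega_seq iter_cp y))].

Definition alpha_limit x : set R :=
  [set y | exists (n : nat -> nat) (u : nat -> R),
     [/\ n j @[j --> \oo] --> \oo,
         forall j, npreim (n j) x (u j)
       & u j @[j --> \oo] --> y]].

Definition basin A : set R := [set x | dom x /\ omega x `<=` A].

Definition forward_invariant A : Prop :=
  forall x, A x -> x <> c -> A (f x).

Definition topological_attractor A : Prop :=
  [/\ compact A, A `<=` `[0, 1], residual_in_open (basin A)
    & forall A', closed A' -> forward_invariant A' -> A' `<` A ->
        residual_in_open (basin A `\` basin A')].

Definition transitive_set A : Prop :=
  exists2 x, A x & closure (pos_orbit x) = A.

Definition periodic_point p : Prop :=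
  exists n, [/\ (0 < n)%N, iter_defined n p & iter n f p = p].

(* [p] is periodic and its orbit is an attracting periodic orbit. *)
Definition attracting_periodic p : Prop :=
  periodic_point p /\
  exists2 e : R, 0 < e &
    `]p, p + e[ `<=` basin (pos_orbit p) \/
    `]p - e, p[ `<=` basin (pos_orbit p).

Definition periodic_attractor A : Prop :=
  finite_set A /\ interior [set x | dom x /\ omega x = A] !=set0.

Definition iter_homeo_on n I : Prop :=
  [/\ forall x, I x -> iter_defined n x,
      {within I, continuous (iter n f)}
    & exists2 g : R -> R, {within iter n f @` I, continuous g} &
        forall x, I x -> g (iter n f x) = x].

Definition wandering_interval I : Prop :=
  [/\ is_interval I, exists x y, [/\ I x, I y & x < y],
      forall n, (0 < n)%N -> iter_homeo_on n I,
      forall i j, (0 < i)%N -> (0 < j)%N -> i <> j ->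
        (iter i f @` I) `&` (iter j f @` I) = set0
    & forall p, attracting_periodic p -> I `&` basin (pos_orbit p) = set0].

End lorenz.

(* Main.v *)
Require Import Defs.
From mathcomp Require Import all_boot all_order all_algebra.
From mathcomp Require Import all_classical all_reals all_analysis.
From mathcomp Require Import lra.
Import Order.TTheory GRing.Theory Num.Theory.
Import numFieldNormedType.Exports.
Local Open Scope classical_set_scope.
Local Open Scope ring_scope.

Set Implicit Arguments.
Unset Strict Implicit.
Unset Printing Implicit Defensive.

(** Why the theorem holds.

    If preimages of some x in the attractor Lambda accumulate everywhere, a
    wandering interval I would contain points u, v with f^n(u) = f^m(v) = x for
    two different positive times n and m, so that f^n(I) and f^m(I) would meet:
    this is [alpha_limit_all_no_wandering].

    Conversely, suppose that there is no wandering interval.  An interval none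
    of whose points ever reaches c is mapped homeomorphically by all iterates.
    If two of its images met, a power of f would move its points monotonically
    and produce either a periodic attractor or an interval of periodic points
    ([homterval_attractor], [no_return]); otherwise it would wander.  Both are
    excluded, hence the preimages of c are dense ([density_of_preimages]), and
    by Baire's theorem a residual set of points accumulates at c
    ([recurrent_point]).

    By density of the preimages of c, any small interval has an image which
    covers a neighborhood of c after an arbitrarily long time.  So it remains
    to see that each x in Lambda has preimages arbitrarily close to c, that is,
    that x belongs to the set [future] of all points reached from
    ]c - d, c + d[, for each d > 0 ([attractor_future]).  The component
    ([window]) of [future] that contains c behaves like a renormalization
    interval: its left and its right half each come back into it after a fixed
    number of iterates, and density of the preimages of c forces these two
    return maps to push points towards c ([left_return], [right_return]).  An
    orbit in the window therefore never comes close to those ends of the window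
    which [future] does not contain, and the closure of the orbit stays in
    [future] ([window_trap]).  Applied to a dense orbit of Lambda, this shows
    that Lambda meets [future] in a closed forward invariant set; applied to a
    typical point of the basin, it shows that the omega-limit set of this point
    is contained in that intersection.  Minimality of the attractor then gives
    that all of Lambda is contained in [future]. *)

(** * Iterates along orbits that avoid the critical point *)

(** The only features of f that the dynamical arguments rely on; they do not
    involve its derivatives. *)
Record increasing_branches {R : realType} (c : R) (f : R -> R) : Prop := {
  branch_c : 0 < c < 1;
  branch_range : forall x, 0 <= x <= 1 -> x <> c -> 0 <= f x <= 1;
  branch_left : forall x y, 0 <= x -> x < y -> y < c -> f x < f y;
  branch_right : forall x y, c < x -> x < y -> y <= 1 -> f x < f y;
  branch_continuous : forall x, 0 <= x <= 1 -> x <> c ->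
    forall e : R, 0 < e -> exists2 d : R, 0 < d &
      forall y, 0 <= y <= 1 -> `|y - x| < d -> `|f y - f x| < e }.

Section iterates.
Context {R : realType} {c : R} {f : R -> R}.
Hypothesis fB : increasing_branches c f.
Implicit Types x y z : R.

Lemma iter_definedP n x :
  iter_defined c f n x <->
  0 <= x <= 1 /\ forall j, (j < n)%N -> iter j f x <> c.
Proof. by rewrite /iter_defined/= in_itv. Qed.

Lemma iter_definedS n x :
  iter_defined c f n.+1 x <-> iter_defined c f n x /\ iter n f x <> c.
Proof.
rewrite !iter_definedP; split=> [[x01 xc]|[[x01 xc] xnc]].
  by split; [split=> // j jn; apply: xc; rewrite ltnS ltnW|exact: xc].
split=> // j; rewrite ltnS leq_eqVlt => /orP[/eqP ->//|]; exact: xc.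
Qed.

Lemma iter_defined_le m n x : (m <= n)%N ->
  iter_defined c f n x -> iter_defined c f m x.
Proof.
by move=> mn [x01 xc]; split=> // j jm; apply: xc; exact: leq_trans mn.
Qed.

Lemma iter_range n x : iter_defined c f n x -> 0 <= iter n f x <= 1.
Proof.
elim: n => [|n IHn]; first by rewrite iter_definedP => -[].
by move=> /iter_definedS[/IHn]; exact: branch_range.
Qed.

Lemma iter_definedD m n x : iter_defined c f m x ->
  iter_defined c f n (iter m f x) -> iter_defined c f (m + n) x.
Proof.
move=> mx nx; elim: n nx => [|n IHn]; first by rewrite addn0.
by rewrite addnS !iter_definedS addnC iterD addnC => -[/IHn].
Qed.

Lemma iter_definedDl m n x : iter_defined c f (m + n) x ->
  iter_defined c f n (iter m f x).
Proof.
move=> mnx; apply/iter_definedP; split.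
  by apply: iter_range; apply: iter_defined_le mnx; exact: leq_addr.
by move=> j jn; rewrite -iterD; apply: mnx.2; rewrite addnC ltn_add2l.
Qed.

(** One-sided at 0 and 1, where f^n is only controlled from within [0,1]. *)
Lemma iter_continuous n x : iter_defined c f n x ->
  forall e : R, 0 < e -> exists2 d : R, 0 < d &
    forall y, 0 <= y <= 1 -> `|y - x| < d ->
      iter_defined c f n y /\ `|iter n f y - iter n f x| < e.
Proof.
elim: n => [x01 e e0|n IHn]; first by exists e => // y y01; rewrite iter_definedP.
move=> /[dup] Sx /iter_definedS[nx xc] e e0.
have [d d0 fd] := branch_continuous fB (iter_range nx) xc e0.
have mindc : 0 < Num.min d `|iter n f x - c|.
  by rewrite lt_min d0 normr_gt0 subr_eq0; exact/eqP.
have [d' d'0 nd] := IHn nx _ mindc; exists d' => // y y01 /(nd y y01)[ny].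
rewrite lt_min => /andP[yd yc]; split; last exact/fd/yd/iter_range.
rewrite iter_definedS; split=> // nyc.
by move: yc; rewrite nyc distrC ltxx.
Qed.

Lemma iter_within_continuous (A : set R) n :
  (forall y, A y -> iter_defined c f n y) ->
  {within A, continuous (iter n f)}.
Proof.
move=> An; apply/subspace_continuousP => x Ax; apply/cvgrPdist_lt => e e0.
have [d d0 nd] := iter_continuous (An x Ax) e0.
exists d => //= y xyd Ay; rewrite distrC; apply: (nd y _ _).2.
  by have /iter_definedP[] := An y Ay.
by rewrite distrC.
Qed.

(** As long as no point of [x, y] reaches c, the images of [x, y] are segments
    that lie on one side of c, where f is increasing. *)
Lemma iter_segment n x y : x < y ->
  (forall z, x <= z <= y -> iter_defined c f n z) ->
  iter n f x < iter n f y /\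
  forall w, iter n f x <= w <= iter n f y ->
    exists2 z, x <= z <= y & iter n f z = w.
Proof.
move=> xy nxy.
have ivt m : (m <= n)%N -> iter m f x < iter m f y ->
    forall w, iter m f x <= w <= iter m f y ->
    exists2 z, x <= z <= y & iter m f z = w.
  move=> mn fxy w xwy.
  have [||z] := @IVT R (iter m f) x y w (ltW xy).
  - apply: iter_within_continuous => z; rewrite /= in_itv/= => xzy.
    by apply: iter_defined_le mn _; exact: nxy.
  - by rewrite minElt maxElt fxy.
  - by rewrite in_itv; exists z.
suff incr m : (m <= n)%N -> iter m f x < iter m f y.
  by split; [exact: incr|apply: ivt => //; exact: incr].
elim: m => // m IHm mn; have fxy := IHm (ltnW mn).
have xn z : x <= z <= y -> iter m f z <> c.
  by move=> /nxy /iter_definedP[_]; exact.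
have mrange z : x <= z <= y -> 0 <= iter m f z <= 1.
  by move=> /nxy nz; apply: iter_range; apply: iter_defined_le nz; apply: ltnW.
have /andP[x0 _] : 0 <= iter m f x <= 1 by apply: mrange; rewrite lexx ltW.
have /andP[_ y1] : 0 <= iter m f y <= 1 by apply: mrange; rewrite lexx ltW.
have [yc|cy] := ltP (iter m f y) c; first exact: (branch_left fB).
have [cx|xc] := ltP c (iter m f x); first exact: (branch_right fB).
have [||z xzy zc] := ivt m _ fxy c; rewrite ?xc ?cy//; first exact: ltnW.
by case: (xn z xzy).
Qed.

End iterates.

(** * Preimages, and intervals that never reach the critical point *)

(** There are finitely many residue classes modulo k, so a point at a positive
    distance from all k limits is avoided from some time on along all of them
    at once. *)
Lemma cluster_periodic_limits {R : realType} (k : nat) (u : nat -> R)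
    (L : 'I_k -> R) : (0 < k)%N ->
  (forall r : 'I_k, u (m * k + r)%N @[m --> \oo] --> L r) ->
  cluster (u @ \oo) = range L.
Proof.
move=> k0 uL; rewrite eqEsubset; split=> a.
  move/cluster_eventuallyP => ua; apply: contrapT => aL.
  have : closed (range L).
    have /accessible_finite_set_closed := hausdorff_accessible (@Rhausdorff R).
    by apply; exact: finite_image.
  rewrite -openC openE => /(_ a aL)/nbhs_ballP[e /= e0 aeL].
  have : \forall m \near \oo, forall r : 'I_k,
      `|L r - u (m * k + r)%N| < e / 2.
    apply: filter_forall => r; move/cvgrPdist_lt : (uL r); apply.
    by rewrite divr_gt0.
  move=> [M _ Mu]; have [|p Mp ap] := ua (e / 2) (M * k)%N; first by rewrite divr_gt0.
  have pk : (p %% k < k)%N by rewrite ltn_pmod.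
  have /= := Mu (p %/ k)%N _ (Ordinal pk); rewrite /= -divn_eq => up.
  apply: (aeL (L (Ordinal pk))); last by exists (Ordinal pk).
  rewrite /ball/= (le_lt_trans (ler_distD (u p) _ _))// (splitr e).
  by rewrite ler_ltD// distrC up// leq_divRL.
move=> [r _ <-]; apply/cluster_eventuallyP => e n e0.
have /cvgrPdist_lt/(_ e e0)[M _ Mu] := uL r.
exists (maxn M n * k + r)%N; last by rewrite ltW// Mu//= leq_max leqnn.
by rewrite (leq_trans _ (leq_addr _ _))// (leq_trans (leq_maxr M n))// leq_pmulr.
Qed.

Section preimages.
Context {R : realType} {c : R} {f : R -> R}.
Hypothesis fB : increasing_branches c f.
Implicit Types x y z : R.

Lemma domP x : dom c x <-> 0 <= x <= 1 /\ x <> c.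
Proof. by rewrite /dom/setD/= in_itv. Qed.

Lemma c01 : 0 <= c <= 1.
Proof. by have /andP[c0 c1] := branch_c fB; rewrite !ltW. Qed.

Lemma npreim_range n x y : 0 <= x <= 1 -> npreim c f n x y -> 0 <= y <= 1.
Proof.
move=> x01; case: n => [->//|n] [[/domP[]//]|[-> _]]; exact: c01.
Qed.

Lemma npreim_iter n k x y : iter_defined c f n y ->
  npreim c f k x (iter n f y) -> npreim c f (n + k) x y.
Proof.
elim: n y => // n IHn y ny; rewrite iterSr => xy; left; split.
  apply/domP; split; last exact: (ny.2 0%N).
    by have /iter_definedP[] := ny.
by apply: IHn xy; exact: (iter_definedDl fB (m := 1)).
Qed.

(** Away from c the inductive definition of preimages, with its exceptional
    clause for the values f(c-) and f(c+), is the usual one. *)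
Lemma npreim_orbit n x y : npreim c f n x y ->
  (forall j, (j < n)%N -> iter j f y <> c) -> iter n f y = x.
Proof.
elim: n y => // n IHn y [[_ xy]|[-> _] /(_ 0%N)/(_ isT)//] yc.
rewrite iterSr; apply: IHn => // j jn.
by have := yc j.+1; rewrite iterSr; exact.
Qed.

Lemma neg_orbitP y : 0 <= y <= 1 ->
  neg_orbit c f c y <-> exists2 n, iter_defined c f n y & iter n f y = c.
Proof.
move=> y01; split=> [[n _]|[n ny yc]]; last first.
  by exists n => //; rewrite -[n]addn0; apply: npreim_iter => //; exact: yc.
elim: n y y01 => [y y01 ->|n IHn y y01].
  by exists 0%N => //; apply/iter_definedP; split=> //; exact: c01.
move=> [[/domP[_ yc] cy]|[-> _]]; last first.
  by exists 0%N => //; apply/iter_definedP; split=> //; exact: c01.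
have [m my mc] := IHn (f y) (branch_range fB y01 yc) cy.
exists m.+1; last by rewrite iterSr.
apply: (iter_definedD (m := 1)) => //.
by apply/iter_definedP; split => // -[].
Qed.

Definition avoids_c y := forall n, iter_defined c f n y.

Lemma avoids_cP y : 0 <= y <= 1 -> avoids_c y <-> ~ neg_orbit c f c y.
Proof.
move=> y01; rewrite (neg_orbitP y01); split=> [yc [n ny ync]|].
  by have /iter_definedS[] := yc n.+1.
move=> nyc; elim => [|n IHn]; first by apply/iter_definedP.
by apply/iter_definedS; split=> // ync; apply: nyc; exists n.
Qed.

Lemma avoids_c01 y : avoids_c y -> 0 <= y <= 1.
Proof. by move=> /(_ 0%N)/iter_definedP[]. Qed.

Lemma avoids_c_iter m y : avoids_c y -> avoids_c (iter m f y).
Proof. by move=> yc n; exact: iter_definedDl. Qed.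

Lemma avoids_c_dom y : avoids_c y -> dom c y.
Proof.
move=> /(_ 1%N)/iter_definedP[y01 yc]; apply/domP.
by split=> //; exact: (yc 0%N).
Qed.

Lemma omega_avoids_c y : avoids_c y ->
  omega c f y = omega_seq (fun n => iter n f y).
Proof.
move=> yc; have /(avoids_cP (avoids_c01 yc)) nyc := yc.
by rewrite eqEsubset; split=> [w [[]|[]]|w]//; left.
Qed.

(** The k-th iterate maps one end of [x, y] to the other one, hence it is
    monotone along the orbit of each point of [x, y]: all these orbits
    converge, modulo k, to the same k limits, which form the omega-limit set
    of all points of the segment. *)
Lemma homterval_attractor k x y : (0 < k)%N -> x < y ->
  (forall z, x <= z <= y -> avoids_c z) ->
  (iter k f x = y \/ iter k f y = x) ->
  exists A, periodic_attractor c f A.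
Proof.
move=> k0 xy xyc kxy.
have mono n z w : x <= z -> z <= w -> w <= y -> iter n f z <= iter n f w.
  move=> xz; rewrite le_eqVlt => /orP[/eqP->//|zw wy]; apply: ltW.
  apply: (iter_segment fB zw (n := n) _).1 => t /andP[zt tw].
  by apply: xyc; rewrite (le_trans xz)//= (le_trans tw).
have bnd n z : x <= z <= y -> 0 <= iter n f z <= 1.
  by move=> /xyc/(_ n); exact: iter_range.
have stepE r m : (m.+1 * k + r = m * k + r + k)%N.
  by rewrite mulSn addnC addnCA addnC [(r + _)%N]addnC.
have [L zL] : exists L : 'I_k -> R, forall z, x <= z <= y ->
    forall r : 'I_k, iter (m * k + r) f z @[m --> \oo] --> L r.
  (* b is the end that f^k maps to the other end; the orbit of z is squeezed
     between those of b and of f^k(b), of which the latter is a shift of the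
     former. *)
  pose b := if iter k f x == y then x else y.
  have bxy : x <= b <= y by rewrite /b; case: ifP => _; rewrite lexx ltW.
  exists (fun r => lim (iter (m * k + r) f b @[m --> \oo])) => z /andP[xz zy] r.
  set s := fun m => iter (m * k + r) f b.
  have sS m : s m.+1 = iter (m * k + r) f (iter k f b) by rewrite /s stepE iterD.
  case: kxy => kxy.
    have {}sS m : s m.+1 = iter (m * k + r) f y.
      by rewrite sS /b kxy eqxx kxy.
    have {bxy}sx m : s m = iter (m * k + r) f x by rewrite /s /b kxy eqxx.
    have scvg : cvgn s.
      apply: nondecreasing_is_cvgn.
        by apply/nondecreasing_seqP => m; rewrite sS sx mono// ltW.
      exists 1 => _ [m _ <-]; rewrite sx.
      by have /andP[] : 0 <= iter (m * k + r) f x <= 1 by rewrite bnd// lexx ltW.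
    apply: (@squeeze_cvgr nat \oo _ R s (fun m => s m.+1));
      [|exact: scvg|by rewrite (cvg_shiftS s)].
    by apply: nearW => m; rewrite sS sx !mono.
  have bE : b = y.
    rewrite /b; case: eqP => // kx; have := mono k x y; rewrite kx kxy !lexx (ltW xy).
    by rewrite leNgt xy => /(_ isT isT isT).
  have {}sS m : s m.+1 = iter (m * k + r) f x by rewrite sS bE kxy.
  have {bxy}sy m : s m = iter (m * k + r) f y by rewrite /s bE.
  have scvg : cvgn s.
    apply: nonincreasing_is_cvgn.
      by apply/nonincreasing_seqP => m; rewrite sS sy mono// ltW.
    exists 0 => _ [m _ <-]; rewrite sy.
    by have /andP[] : 0 <= iter (m * k + r) f y <= 1 by rewrite bnd// lexx ltW.
  apply: (@squeeze_cvgr nat \oo _ R (fun m => s m.+1) s);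
    [|by rewrite (cvg_shiftS s)|exact: scvg].
  by apply: nearW => m; rewrite sS sy !mono.
exists (range L); split; first exact: finite_image.
exists ((x + y) / 2).
have /near_in_itvoo : (x + y) / 2 \in `]x, y[ by rewrite in_itv/= !midf_lt.
rewrite /interior/=; apply: filterS => z; rewrite in_itv/= => /andP[/ltW xz /ltW zy].
have xzy : x <= z <= y by rewrite xz.
split; first by apply: avoids_c_dom; exact: xyc.
rewrite omega_avoids_c ?/omega_seq; last exact: xyc.
exact: cluster_periodic_limits (zL z xzy).
Unshelve. all: by end_near. Qed.

End preimages.
Arguments avoids_c {R} c f y.

(** * Generic points are recurrent to the critical point *)

Section recurrence.
Context {R : realType} {c : R} {f : R -> R}.
Hypothesis fB : increasing_branches c f.
Implicit Types x y z : R.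

(** f^n takes the value c at most once on a segment where it is increasing, so
    one of two disjoint subsegments misses this point. *)
Lemma shrink_defined n x y : 0 <= x -> x < y -> y <= 1 ->
  exists x' y', [/\ x <= x', x' < y', y' <= y &
    forall z, x' <= z <= y' -> iter_defined c f n z].
Proof.
move=> x0 xy y1; elim: n => [|n [x' [y' [xx' x'y' y'y nxy]]]].
  exists x, y; split=> // z /andP[xz zy]; apply/iter_definedP; split=> //.
  by rewrite (le_trans x0)//= (le_trans zy).
pose s := x' + (y' - x') / 3; pose t := x' + (y' - x') / 3 * 2.
have [s1 s2 s3] : [/\ x' < s, s < t & t < y'] by rewrite /s /t; split; lra.
have [[z /andP[x'z zs] zc]|nc] :=
  pselect (exists2 z, x' <= z <= s & iter n f z = c).
  exists t, y'; split=> // [|w /andP[tw wy']].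
    by rewrite (le_trans xx')// ltW// (lt_trans s1).
  apply/iter_definedS; split.
    by apply: nxy; rewrite wy' (le_trans _ tw)// ltW// (lt_trans s1).
  have zw : z < w by rewrite (le_lt_trans zs)// (lt_le_trans s2).
  have [|+ _] := iter_segment fB zw (n := n).
    move=> v /andP[zv vw]; apply: nxy.
    by rewrite (le_trans x'z zv) (le_trans vw wy').
  by rewrite zc => /[swap] ->; rewrite ltxx.
exists x', s; split=> // [|w /andP[x'w ws]].
  by rewrite (le_trans _ y'y)// ltW// (lt_trans s2).
apply/iter_definedS; split; last by move=> wc; apply: nc; exists w; rewrite ?x'w.
by apply: nxy; rewrite x'w/= (le_trans ws)// ltW// (lt_trans s2).
Qed.

Lemma open_segment (O : set R) z : open O -> O z ->
  exists x y, x < z < y /\ `[x, y] `<=` O.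
Proof.
rewrite openE => /(_ z)/[apply]/nbhs_ballP[e /= e0 eO].
exists (z - e / 2), (z + e / 2); split; first by apply/andP; split; lra.
move=> w; rewrite /= in_itv/= => /andP[zw wz]; apply: eO.
by rewrite /ball/= ltr_norml; apply/andP; split; lra.
Qed.

(** Baire category: if the preimages of c are dense in U, the points that come
    1/(k+1)-close to c at a time at least k contain an open dense subset of U
    for each k.  A point with this property for all k avoids c, because its
    iterates are defined at arbitrarily large times. *)
Lemma recurrent_point (U B : set R) :
  open U -> U !=set0 -> U `<=` `[0, 1] ->
  (forall x y, x < y -> `[x, y] `<=` U ->
     exists2 z, x < z < y & neg_orbit c f c z) ->
  residual_in U B ->
  exists y, [/\ U y, B y, avoids_c c f y &
    cluster (iter n f y @[n --> \oo]) c].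
Proof.
move=> oU [z0 Uz0] U01 Uc [G [oG GB]].
pose P k := [set y | exists n, [/\ (k <= n)%N, iter_defined c f n y &
  `|iter n f y - c| < k.+1%:R^-1]].
(* G k is dense in U only; the exterior of U makes F k dense in the line. *)
pose F k := (G k `&` (P k)°) `|` ~` closure U.
have FP k : open (F k) /\ dense (F k).
  split.
    apply: openU; last by rewrite openC; exact: closed_closure.
    by apply: openI; [exact: (oG k).1|exact: open_interior].
  move=> O [z Oz] oO.
  have [|nUz] := pselect (closure U z); last by exists z; split=> //; right.
  move=> /(_ O (open_nbhs_nbhs (conj oO Oz)))[w [Uw Ow]].
  have oOU : open (O `&` U) by exact: openI.
  have [w' [[Uw' Gw'] [Ow' _]]] :=
    (oG k).2 w Uw _ (open_nbhs_nbhs (conj oOU (conj Ow Uw))).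
  have oO3 : open (O `&` U `&` G k) by apply: openI => //; exact: (oG k).1.
  have [x [y [/andP[xw' w'y] xyO]]] := open_segment oO3 (conj (conj Ow' Uw') Gw').
  have xy := lt_trans xw' w'y.
  have seg01 v : x <= v <= y -> 0 <= v <= 1.
    by move=> xvy; have [[_ /U01]] : (O `&` U `&` G k) v;
       [apply: xyO; rewrite /= in_itv|rewrite /= in_itv].
  have /andP[x0 _] : 0 <= x <= 1 by rewrite seg01// lexx ltW.
  have /andP[_ y1] : 0 <= y <= 1 by rewrite seg01// lexx ltW.
  have [x' [y' [xx' x'y' y'y kxy]]] := shrink_defined k x0 xy y1.
  have [|v /andP[x'v vy'] vc] := Uc _ _ x'y'.
    move=> v; rewrite /= in_itv/= => /andP[x'v vy'].
    have [] // : (O `&` U `&` G k) v.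
      by apply: xyO; rewrite /= in_itv/= (le_trans xx')// (le_trans vy').
    by case.
  have xvy : x <= v <= y by rewrite (le_trans xx' (ltW x'v)) (le_trans (ltW vy')).
  have Ov : (O `&` U `&` G k) v by apply: xyO; rewrite /= in_itv.
  exists v; split; first by case: Ov => -[].
  left; split; first by case: Ov.
  have [n nv nvc] := (neg_orbitP fB (seg01 _ xvy)).1 vc.
  have kn : (k <= n)%N.
    rewrite leqNgt; apply/negP => nk; apply: (kxy v _).2 nvc => //.
    by rewrite (ltW x'v) (ltW vy').
  have k0 : 0 < k.+1%:R^-1 :> R by rewrite invr_gt0 ltr0n.
  have [d d0 nd] := iter_continuous fB nv k0.

  have /near_in_itvoo : v \in `]x', y'[ by rewrite in_itv/= x'v.
  rewrite /interior/=; apply: filterS2 (nbhsx_ballx v d d0) => w'' dw.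
  rewrite in_itv/= => /andP[/ltW x'w /ltW wy'].
  have w01 : 0 <= w'' <= 1 by rewrite seg01// (le_trans xx')// (le_trans wy').
  have [|nw wc] := nd w'' w01; first by rewrite distrC; exact: dw.
  by exists n; split=> //; rewrite -nvc.
have [||y [/= Uy]] := @Baire R R^o F FP U; [by exists z0|exact: oU|].
move=> Fy.
have GPy k : G k y /\ P k y.
  have [[Gy /interior_subset Py]//|] := Fy k I.
  by case; exact: subset_closure.
exists y; split => //.
- by apply: GB; split=> // k _; exact: (GPy k).1.
- by move=> n; have [_ [m [nm my _]]] := GPy n; exact: iter_defined_le nm my.
- apply/cluster_eventuallyP => e N e0; near \oo => k.
  have [_ [n [kn _ nc]]] := GPy k; exists n.
    by apply: leq_trans kn; near: k; exact: nbhs_infty_ge.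
  rewrite distrC (le_trans (ltW nc))// ltW//; near: k.
  exact: (near_infty_natSinv_lt (PosNum e0)).
Unshelve. all: by end_near. Qed.

End recurrence.

(** * Density of the preimages of the critical point *)

Section density.
Context {R : realType} {c : R} {f : R -> R}.
Hypothesis fB : increasing_branches c f.
Implicit Types x y z p q : R.

Lemma periodic_avoids_c p : periodic_point c f p ->
  avoids_c c f p /\ exists2 n, (0 < n)%N & forall m, iter (m * n) f p = p.
Proof.
move=> [n [n0 np npp]].
have mp m : iter_defined c f (m * n) p /\ iter (m * n) f p = p.
  elim: m => [|m [mp mpp]]; last first.
    rewrite mulSn addnC; split; first by apply: iter_definedD; rewrite ?mpp.
    by rewrite addnC iterD mpp.
  by split=> //; apply: iter_defined_le np.
split; last by exists n => // m; exact: (mp m).2.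
move=> m; have [+ _] := mp m; apply: iter_defined_le.
by rewrite leq_pmulr.
Qed.

Lemma pos_orbit_avoids_c p : avoids_c c f p ->
  pos_orbit c f p = range (fun j => iter j f p).
Proof.
move=> pc; have /(avoids_cP fB (avoids_c01 pc)) np := pc.
rewrite eqEsubset; split=> [w [[j _ <-]|[]//]|w [j _ <-]]; first by exists j.
by left; exists j => // i _; have /iter_definedS[] := pc i.+1.
Qed.

Lemma periodic_orbit_finite p : periodic_point c f p ->
  finite_set (pos_orbit c f p).
Proof.
move=> pp; have [pc [n n0 npp]] := periodic_avoids_c pp.
rewrite pos_orbit_avoids_c//.
apply: (@sub_finite_set _ _ ((fun j => iter j f p) @` `I_n)).
  move=> w [j _ <-]; exists (j %% n)%N; first by rewrite /= ltn_pmod.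
  by rewrite [in RHS](divn_eq j n) addnC iterD npp.
exact/finite_image/finite_II.
Qed.

(** f is continuous at q, so it carries a subsequence that converges to q to one
    that converges to f(q). *)
Lemma omega_seq_forward y q : avoids_c c f y -> q <> c ->
  omega_seq (fun n => iter n f y) q -> omega_seq (fun n => iter n f y) (f q).
Proof.
move=> yc qc yq.
have q01 : 0 <= q <= 1.
  have : closed `[0 : R, 1] by exact: itv_closed.
  move=> /(_ q); rewrite /= in_itv/=; apply=> V Vq.
  have [|w wV] := yq `[0, 1]%classic V _ Vq; last by exists w.
  by exists 0%N => // n _; rewrite /= in_itv/=; exact: (iter_range fB (yc n)).
apply/cluster_eventuallyP => e N e0.
have [d d0 qd] := branch_continuous fB q01 qc e0.
move/cluster_eventuallyP : yq => /(_ (d / 2) N)[|n Nn qn]; first by rewrite divr_gt0.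
exists n.+1; first exact: leqW.
rewrite /= distrC ltW//; apply: qd; first exact: (iter_range fB (yc n)).
by rewrite distrC (le_lt_trans qn)//; lra.
Qed.

Lemma omega_avoids_c_nonempty y : avoids_c c f y ->
  omega_seq (fun n => iter n f y) !=set0.
Proof.
move=> yc; have := @segment_compact R 0 1 (iter n f y @[n --> \oo]) _.
case=> [|q [_ yq]]; last by exists q.
by exists 0%N => // n _; rewrite /= in_itv/=; exact: (iter_range fB (yc n)).
Qed.

(** The omega-limit set is non-empty and forward invariant, and a periodic orbit
    has no proper non-empty forward invariant subset. *)
Lemma omega_periodic_orbit p y : periodic_point c f p -> avoids_c c f y ->
  omega c f y `<=` pos_orbit c f p -> omega c f y = pos_orbit c f p.
Proof.
move=> pp yc; rewrite omega_avoids_c// => yp.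
have [pc [n n0 npp]] := periodic_avoids_c pp.
rewrite eqEsubset; split=> //.
have [q yq] := omega_avoids_c_nonempty yc.
have := yp q yq; rewrite pos_orbit_avoids_c// => -[i _ ipq] _ [j _ <-].
have ji k : omega_seq (fun n => iter n f y) (iter (k + i) f p).
  elim: k => [|k IHk]; first by rewrite add0n ipq.
  apply: omega_seq_forward => //.
  by have /iter_definedS[] := pc (k + i).+1.
have := ji (j + (i * n - i))%N; rewrite -addnA subnK ?leq_pmulr//.
by rewrite iterD npp.
Qed.

(** Points next to p may be preimages of c, for which the omega-limit set is
    that of c- and c+.  If some interval next to p is free of them, the
    omega-limit set is the orbit of p on this interval.  Otherwise
    [recurrent_point] gives a point of the basin of p that accumulates at c,
    which is impossible since the orbit of p avoids c. *)
Lemma attracting_periodic_attractor p : attracting_periodic c f p ->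
  exists A, periodic_attractor c f A.
Proof.
move=> [pp [e e0 pe]].
have [pc _] := periodic_avoids_c pp.
have [a [b [ab abp]]] : exists a b, a < b /\
    `]a, b[ `<=` basin c f (pos_orbit c f p).
  by case: pe => pe; [exists p, (p + e)|exists (p - e), p]; split=> //; lra.
have [[x [y [xy xyab xyc]]]|nxy] := pselect (exists x y, [/\ x < y,
    `]x, y[ `<=` `]a, b[ & forall z, x < z < y -> ~ neg_orbit c f c z]).
  exists (pos_orbit c f p); split; first exact: periodic_orbit_finite.
  have /near_in_itvoo mxy : (x + y) / 2 \in `]x, y[ by rewrite in_itv/= !midf_lt.
  exists ((x + y) / 2); rewrite /interior/=; apply: filterS mxy => z.
  rewrite in_itv/= => xzy; have /abp[/[dup] zdom /domP[z01 _] zp] : `]a, b[%classic z.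
    by apply: xyab; rewrite /= in_itv.
  split=> //; apply: omega_periodic_orbit => //.
  by apply/(avoids_cP fB z01); exact: xyc.
have [|||||z [_ /abp[_ zp] zc cz]] := @recurrent_point R c f fB `]a, b[ `]a, b[.
- exact: interval_open.
- by exists ((a + b) / 2); rewrite /= in_itv/= !midf_lt.
- by move=> z /abp[/domP[z01 _] _]; rewrite /= in_itv.
- move=> x y xy xyab; apply: contrapT => nxyc; apply: nxy; exists x, y; split=> //.
    move=> z; rewrite /= in_itv/= => /andP[xz zy]; apply: xyab.
    by rewrite /= in_itv/= !ltW.
  by move=> z xzy zc; apply: nxyc; exists z.
- exists (fun=> setT); split; last by move=> z [].
  by move=> k; split; [exact: openT|rewrite setIT; exact: subset_closure].
- move: zp; rewrite omega_avoids_c// => /(_ c cz); rewrite pos_orbit_avoids_c//.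
  by move=> [j _ jc]; have /iter_definedS[] := pc j.+1.
Qed.

(** If f^k(z) were in [x, y], then z would be fixed by f^k by
    [homterval_attractor].  Another point w of [x, y] is fixed too: the segment
    between w and f^k(w) is contained in the union of [x, y] and of the image
    of the segment between z and w, so [homterval_attractor] applies to it.
    But f^k is not the identity on any interval. *)
Lemma no_return x y z k :
  ~ (exists A, periodic_attractor c f A) ->
  ~ (exists a b n, [/\ a < b, (0 < n)%N &
      forall x, a < x < b -> iter_defined c f n x /\ iter n f x = x]) ->
  x < y -> (forall w, x <= w <= y -> avoids_c c f w) -> (0 < k)%N ->
  x <= z <= y -> ~ (x <= iter k f z <= y).
Proof.
move=> nA nI xy xyc k0 zxy kzxy.
have moved u v : u < v -> (forall w, u <= w <= v -> avoids_c c f w) ->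
    ~ (iter k f u = v \/ iter k f v = u).
  by move=> uv uvc kuv; exact: nA (homterval_attractor fB k0 uv uvc kuv).
have [/andP[xz zy] /andP[xkz kzy]] := (zxy, kzxy).
(* The segment between z and f^k(z) is contained in [x, y], so its points avoid
   c and it has to be trivial. *)
have kz : iter k f z = z.
  have [kz|kz|//] := ltgtP (iter k f z) z.
    have [] := moved _ _ kz; last by right.
    by move=> w /andP[w1 w2]; apply: xyc; rewrite (le_trans xkz)//= (le_trans w2).
  have [] := moved _ _ kz; last by left.
  by move=> w /andP[w1 w2]; apply: xyc; rewrite (le_trans xz)//= (le_trans w2).
have incr u v : x <= u -> u < v -> v <= y ->
    (iter k f u < iter k f v) /\ (forall t, iter k f u <= t <= iter k f v ->
    exists2 s, u <= s <= v & iter k f s = t).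
  move=> xu uv vy; apply: (iter_segment fB) => // s /andP[us sv]; apply: xyc.
  by rewrite (le_trans xu)//= (le_trans sv).
have sub u v : x <= u -> v <= y ->
    forall w, u <= w <= v -> avoids_c c f w.
  move=> xu vy w /andP[uw wv]; apply: xyc.
  by rewrite (le_trans xu)//= (le_trans wv).
apply: nI; exists x, y, k; split=> // w /andP[/ltW xw /ltW wy].
split; first by apply: xyc; rewrite xw.
have [kw|wk|//] := ltgtP (iter k f w) w.
- have [] := moved _ _ kw; last by right.
  have [zw|wz|wz] := ltgtP z w; last by rewrite -wz kz wz ltxx in kw.
    have [kzw _] := incr z w xz zw wy.
    by apply: sub => //; rewrite (le_trans xz)// -{1}kz ltW.
  (* f^k(w) is outside [w, z], but f^k maps this segment onto [f^k(w), z]. *)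
  have [_ kwz] := incr w z xw wz zy.
  move=> t /andP[kwt tw]; have [|s /andP[ws sz] <-] := kwz t.
    by rewrite kwt kz (le_trans tw)// ltW.
  by apply: avoids_c_iter => //; apply: (sub w z) => //; rewrite ws.
- have [] := moved _ _ wk; last by left.
  have [zw|wz|wz] := ltgtP z w; last by rewrite -wz kz wz ltxx in wk.
    have [_ kzw] := incr z w xz zw wy.
    move=> t /andP[wt tkw]; have [|s /andP[zs sw] <-] := kzw t.
      by rewrite tkw kz andbT (le_trans _ wt)// ltW.
    by apply: avoids_c_iter => //; apply: (sub z w) => //; rewrite zs.
  have [kwz _] := incr w z xw wz zy.
  by apply: sub => //; rewrite (le_trans _ zy)// -{1}kz ltW.
Qed.

(** A closed subinterval whose points all avoid c would be wandering: its images
    are disjoint by [no_return], and no point is attracted by a periodic orbit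
    by [attracting_periodic_attractor]. *)
Lemma density_of_preimages x y :
  ~ (exists I, wandering_interval c f I) ->
  ~ (exists A, periodic_attractor c f A) ->
  ~ (exists a b n, [/\ a < b, (0 < n)%N &
      forall x, a < x < b -> iter_defined c f n x /\ iter n f x = x]) ->
  0 <= x -> x < y -> y <= 1 -> exists2 z, x < z < y & neg_orbit c f c z.
Proof.
move=> nW nA nI x0 xy y1; apply: contrapT => nxy.
(* The candidate is closed, so that the inverses of the iterates on it are
   continuous up to its ends. *)
pose a := x + (y - x) / 3; pose b := x + (y - x) / 3 * 2.
have [xa ab by_] : [/\ x < a, a < b & b < y] by rewrite /a /b; split; lra.
have abc z : a <= z <= b -> avoids_c c f z.
  move=> /andP[az zb]; have xz := lt_le_trans xa az; have zy := le_lt_trans zb by_.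
  apply/(avoids_cP fB); first by rewrite (le_trans x0 (ltW xz)) (le_trans (ltW zy)).
  by move=> zc; apply: nxy; exists z; rewrite ?xz.
have incr n z w : a <= z -> z < w -> w <= b ->
    (iter n f z < iter n f w) /\ (forall t, iter n f z <= t <= iter n f w ->
    exists2 s, z <= s <= w & iter n f s = t).
  move=> az zw wb; apply: (iter_segment fB) => // s /andP[zs sw]; apply: abc.
  by rewrite (le_trans az)//= (le_trans sw).
have inj n z w : a <= z <= b -> a <= w <= b -> iter n f z = iter n f w -> z = w.
  move=> /andP[az zb] /andP[aw wb] zw; have [zlw|wlz|//] := ltgtP z w.
    by have [+ _] := incr n z w az zlw wb; rewrite zw ltxx.
  by have [+ _] := incr n w z aw wlz zb; rewrite zw ltxx.
apply: nW; exists `[a, b]%classic; split.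
- exact: interval_is_interval.
- by exists a, b; rewrite /= !in_itv/= !lexx ltW.
- move=> n n0; split; first by move=> z; rewrite /= in_itv/= => /abc.
    by apply: (iter_within_continuous fB) => z; rewrite /= in_itv/= => /abc.
  pose g w := xget 0 [set z | a <= z <= b /\ iter n f z = w].
  have gK z : a <= z <= b -> g (iter n f z) = z.
    move=> zab.
    have [] := @xgetPex _ 0 [set z' | a <= z' <= b /\ iter n f z' = iter n f z].
      by exists z.
    by move=> gab /(inj n _ _ gab zab).
  exists g; last by move=> z; rewrite /= in_itv/=; exact: gK.
  apply: (@continuous_subspaceW _ _ _ `[iter n f a, iter n f b]%classic).
    move=> _ [z + <-]; rewrite /= !in_itv/= => /andP[az zb].
    have le u v : a <= u -> u <= v -> v <= b -> iter n f u <= iter n f v.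
      move=> au; rewrite le_eqVlt => /orP[/eqP->//|uv vb]; apply: ltW.
      by have [] := incr n u v au uv vb.
    by rewrite !le.
  apply: segment_can_le_continuous; first exact: ltW.
    by apply: (iter_within_continuous fB) => z; rewrite /= in_itv/= => /abc.
  by move=> z; rewrite in_itv/=; exact: gK.
- have disj i j : (i < j)%N ->
      (iter i f @` `[a, b]) `&` (iter j f @` `[a, b]) = set0.
    move=> ij; rewrite -subset0 => _ [[s + <-] [t + tj]].
    rewrite /= !in_itv/= => sab tab.
    have lab z : a <= z <= b -> iter i f a <= iter i f z <= iter i f b.
      have le u v : a <= u -> u <= v -> v <= b -> iter i f u <= iter i f v.
        move=> au; rewrite le_eqVlt => /orP[/eqP->//|uv vb]; apply: ltW.
        by have [] := incr i u v au uv vb.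
      by move=> /andP[az zb]; rewrite !le.
    have [iab iabz] := incr i a b (lexx a) ab (lexx b).
    apply: (@no_return _ _ (iter i f t) (j - i) nA nI iab).
    - by move=> w /iabz[z zab <-]; apply: avoids_c_iter => //; exact: abc.
    - by rewrite subn_gt0.
    - exact: lab.
    - by rewrite -iterD subnK ?(ltnW ij)// tj; exact: lab.
  move=> i j _ _ /eqP; rewrite neq_ltn => /orP[|ji]; first exact: disj.
  by rewrite setIC; exact: disj.
- move=> p pp; have := attracting_periodic_attractor pp => /nA[].
Qed.

End density.

(** * One-sided orbits of the critical point *)

Section lateral_values.
Context {R : realType} {c : R} {f : R -> R}.
Hypothesis fB : increasing_branches c f.

Lemma cvg_iter_cm1 : f x @[x --> c^'-] --> iter_cm c f 1.
Proof.
have /andP[c0 c1] := branch_c fB.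
apply: nondecreasing_at_left_is_cvgr.
  near=> x => y z; rewrite !in_itv/= => /andP[xy yc] /andP[xz zc].
  rewrite le_eqVlt => /orP[/eqP->//|yz].
  apply/ltW/(branch_left fB) => //; apply: ltW; apply: lt_trans xy.
  by near: x; exact: nbhs_left_gt.
near=> x.
have x0 : 0 < x by near: x; exact: nbhs_left_gt.
exists 1 => _ [y + <-]; rewrite /= in_itv/= => /andP[xy yc].
have /andP[] // : 0 <= f y <= 1.
apply: (branch_range fB); last by move=> ycE; rewrite ycE ltxx in yc.
by rewrite (ltW (lt_trans yc c1)) andbT ltW// (lt_trans _ xy).
Unshelve. all: by end_near. Qed.

Lemma cvg_iter_cp1 : f x @[x --> c^'+] --> iter_cp c f 1.
Proof.
have /andP[c0 c1] := branch_c fB.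
apply: nondecreasing_at_right_is_cvgr.
  near=> x => y z; rewrite !in_itv/= => /andP[cy yx] /andP[cz zx].
  rewrite le_eqVlt => /orP[/eqP->//|yz].
  apply/ltW/(branch_right fB) => //; apply: ltW; apply: (lt_trans zx).
  by near: x; exact: nbhs_right_lt.
near=> x.
have x1 : x < 1 by near: x; exact: nbhs_right_lt.
exists 0 => _ [y + <-]; rewrite /= in_itv/= => /andP[cy yx].
have /andP[] // : 0 <= f y <= 1.
apply: (branch_range fB); last by move=> ycE; rewrite ycE ltxx in cy.
by rewrite (ltW (lt_trans c0 cy))/= ltW// (lt_trans yx).
Unshelve. all: by end_near. Qed.

Lemma cvg_range (F : set_system R) (l : R) : ProperFilter F ->
  (\forall x \near F, 0 <= x <= 1 /\ x <> c) -> f x @[x --> F] --> l ->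
  0 <= l <= 1.
Proof.
move=> PF F01 fl; have Ffx : \forall x \near F, 0 <= f x <= 1.
  by apply: filterS F01 => x [x01 xc]; exact: (branch_range fB).
apply/andP; split.
  by apply: cvgr_to_ge fl _; apply: filterS Ffx => x /andP[].
by apply: cvgr_to_le fl _; apply: filterS Ffx => x /andP[].
Qed.

Lemma near_left_branch : \forall x \near c^'-, 0 <= x <= 1 /\ x <> c.
Proof.
have /andP[c0 c1] := branch_c fB; near=> x.
have xc : x < c by near: x; exact: nbhs_left_lt.
split; last by move=> xE; rewrite xE ltxx in xc.
have x0 : 0 <= x by near: x; exact: nbhs_left_ge.
by rewrite x0 (ltW (lt_trans xc c1)).
Unshelve. all: by end_near. Qed.

Lemma near_right_branch : \forall x \near c^'+, 0 <= x <= 1 /\ x <> c.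
Proof.
have /andP[c0 c1] := branch_c fB; near=> x.
have cx : c < x by near: x; exact: nbhs_right_gt.
split; last by move=> xE; rewrite xE ltxx in cx.
have x1 : x <= 1 by near: x; exact: nbhs_right_le.
by rewrite x1 (ltW (lt_trans c0 cx)).
Unshelve. all: by end_near. Qed.

Lemma iter_cm1_range : 0 <= iter_cm c f 1 <= 1.
Proof. exact: cvg_range near_left_branch cvg_iter_cm1. Qed.

Lemma iter_cp1_range : 0 <= iter_cp c f 1 <= 1.
Proof. exact: cvg_range near_right_branch cvg_iter_cp1. Qed.

(** Once f(x) has converged to l, the other iterates are continuous at l as long
    as the orbit of l has not reached c. *)
Lemma cvg_iterS (F : set_system R) (l : R) i : ProperFilter F ->
  (\forall x \near F, 0 <= x <= 1 /\ x <> c) -> f x @[x --> F] --> l ->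
  iter_defined c f i l -> iter i.+1 f x @[x --> F] --> iter i f l.
Proof.
move=> PF F01 /cvgrPdist_lt fl il; apply/cvgrPdist_lt => e e0.
have [d d0 id] := iter_continuous fB il e0.
apply: filterS2 F01 (fl d d0) => x [x01 xc] fxl.
rewrite iterSr distrC.
have fx01 : 0 <= f x <= 1 by exact: (branch_range fB).
by have [|] := id (f x) fx01; first by rewrite distrC.
Qed.

Lemma iter_cmS i : iter_defined c f i (iter_cm c f 1) ->
  iter_cm c f i.+1 = iter i f (iter_cm c f 1).
Proof.
move=> il; apply: (cvg_lim (@Rhausdorff R)).
exact: cvg_iterS near_left_branch cvg_iter_cm1 il.
Qed.

Lemma iter_cpS i : iter_defined c f i (iter_cp c f 1) ->
  iter_cp c f i.+1 = iter i f (iter_cp c f 1).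
Proof.
move=> il; apply: (cvg_lim (@Rhausdorff R)).
exact: cvg_iterS near_right_branch cvg_iter_cp1 il.
Qed.

Lemma iter_cm0 : iter_cm c f 0 = c.
Proof.
apply: (cvg_lim (@Rhausdorff R)); apply: cvg_within_filter; exact: cvg_id.
Qed.

Lemma iter_cp0 : iter_cp c f 0 = c.
Proof.
apply: (cvg_lim (@Rhausdorff R)); apply: cvg_within_filter; exact: cvg_id.
Qed.

(** Both lateral orbits are treated together: u is the sequence of the lateral
    iterates at c- or at c+, and l is its first term after c. *)
Section lateral_orbits.
Context {u : nat -> R} {l : R}.
Hypothesis l01 : 0 <= l <= 1.
Hypothesis u0 : u 0%N = c.
Hypothesis uS : forall i, iter_defined c f i l -> u i.+1 = iter i f l.

Lemma lateral_iter_defined i :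
  (forall j, (0 < j < i.+1)%N -> u j <> c) -> iter_defined c f i l.
Proof.
elim: i => [_|i IHi uc]; first by apply/iter_definedP.
have il : iter_defined c f i l.
  by apply: IHi => j /andP[j0 ji]; apply: uc; rewrite j0/= ltnW.
by apply/iter_definedS; split=> //; rewrite -uS//; apply: uc; rewrite ltnS leqnn.
Qed.

Lemma lateral_orbit_sub : lateral_orbit c u `<=`
  c |` [set iter j f l | j in [set j | forall i, (i < j)%N -> iter i f l <> c]].
Proof.
move=> _ [[|j] jc <-]; first by left.
have jl := lateral_iter_defined jc.
by right; exists j; [exact: jl.2|rewrite uS].
Qed.

Lemma lateral_orbit_forward w : lateral_orbit c u w -> w <> c ->
  lateral_orbit c u (f w).
Proof.
move=> [[|j] jc <-] wc; first by [].
have jl := lateral_iter_defined jc.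
exists j.+2; last first.
  by rewrite [RHS]/= !uS//; apply/iter_definedS; split=> //; rewrite -uS.
move=> i /andP[i0]; rewrite ltnS leq_eqVlt => /orP[/eqP->//|ij].
by apply: jc; rewrite i0.
Qed.

End lateral_orbits.

End lateral_values.

(** * The window of points reached from a neighborhood of the critical point *)

Section window.
Context {R : realType} {c : R} {f : R -> R} {d : R}.
Hypothesis fB : increasing_branches c f.
Hypothesis dense_c : forall x y, 0 <= x -> x < y -> y <= 1 ->
  exists2 z, x < z < y & neg_orbit c f c z.
Hypothesis d0 : 0 < d.
Hypothesis d01 : forall x, `|x - c| < d -> 0 <= x <= 1.
Implicit Types (x y z u v w : R) (S : set R).

(** The points reached from the d-neighborhood of c by forward iteration, where
    c itself may be continued by f(c-) or by f(c+). *)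
Definition future : set R :=
  [set w | exists n u, `|u - c| < d /\ npreim c f n w u].

(** The connected component of c in [future]. *)
Definition window : set R :=
  [set y | forall z, Num.min c y <= z <= Num.max c y -> future z].

Lemma near_future w : `|w - c| < d -> future w.
Proof. by move=> wc; exists 0%N, w. Qed.

Lemma future_f w : future w -> dom c w -> future (f w).
Proof.
move=> [n [u [uc uw]]] wc; exists n.+1, u; split=> //.
suff mono (A B : set R) : A `<=` B ->
    iter n (Defs.preim c f) A `<=` iter n (Defs.preim c f) B.
  by rewrite /npreim iterSr; apply: mono uw => _ ->; left.
move=> AB; elim: n {uw} => //= n IHn y [[yc /IHn yB]|[-> yB]]; first by left.
by right; split=> //; case: yB => /IHn; [left|right].
Qed.

Lemma future_cm : future (iter_cm c f 1).
Proof. by exists 1%N, c; rewrite subrr normr0; split=> //; right; split=> //; left. Qed.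

Lemma future_cp : future (iter_cp c f 1).
Proof. by exists 1%N, c; rewrite subrr normr0; split=> //; right; split=> //; right. Qed.

Lemma future_iter n w : future w -> iter_defined c f n w -> future (iter n f w).
Proof.
move=> wF; elim: n => // n IHn /iter_definedS[nw nwc].
apply: future_f; first exact: IHn.
by apply/domP; split=> //; exact: (iter_range fB).
Qed.

Lemma future_range w : future w -> 0 <= w <= 1.
Proof.
move=> [n [u [/d01 u01 uw]]]; elim: n u u01 uw => [u u01 <-//|n IHn u u01].
case=> [[/domP[_ uc]]|[_]]; first by apply: IHn; exact: (branch_range fB).
by case; apply: IHn; [exact: (iter_cm1_range fB)|exact: (iter_cp1_range fB)].
Qed.

Lemma window_future y : window y -> future y.
Proof. by apply; rewrite ge_min le_max !lexx !orbT. Qed.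

Lemma near_window y : `|y - c| < d -> window y.
Proof.
move=> yc z zcy; apply: near_future; apply: le_lt_trans yc.
move: zcy; case: (ltP c y) => cy /andP[cz zy].
  by rewrite !ger0_norm; lra.
by rewrite !ler0_norm; lra.
Qed.

Lemma c_window : window c.
Proof. by apply: near_window; rewrite subrr normr0. Qed.

Lemma window_hull u v w : window u -> window v -> u <= w <= v -> window w.
Proof.
move=> uD vD /andP[uw wv] z; case: (ltP c w) => cw /andP[z1 z2].
  by apply: vD; case: (ltP c v) => ?; apply/andP; split; lra.
by apply: uD; case: (ltP c u) => ?; apply/andP; split; lra.
Qed.

(** The window is maximal: it absorbs a segment of [future] that meets it. *)
Lemma window_extend v w : window v ->
  (forall z, Num.min v w <= z <= Num.max v w -> future z) -> window w.
Proof.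
move=> vD vw z zcw.
have [zcv|zcv] := boolP (Num.min c v <= z <= Num.max c v); first exact: vD.
apply: vw; move: zcw zcv.
by case: (ltP c w); case: (ltP c v); case: (ltP v w) => ? ? ? /andP[? ?];
  rewrite negb_and -!ltNge => /orP[] ?; apply/andP; split; lra.
Qed.

(** As a component, the window is closed relative to [future]. *)
Lemma window_limit l : future l ->
  (forall e, 0 < e -> exists2 y, window y & `|y - l| < e) -> window l.
Proof.
move=> lF lD z; case: (eqVneq z l) => [->//|zl zcl].
have [|y yD yl] := lD `|z - l|; first by rewrite normr_gt0 subr_eq0.
apply: yD; move: zcl yl.
by case: (ltP c l); case: (ltP c y) => ? ? /andP[? ?];
  rewrite ltr_norml; case: (lerP z l) => ? /andP[? ?];
  apply/andP; split; lra.
Qed.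

(** S stands for the left or the right half of the window.  It contains a
    preimage of c, so some image of S meets the window; as long as this has not
    happened, the images of S miss c.  The first image that meets the window is
    a segment of [future], so it is contained in the window. *)
Lemma first_return S : S `<=` window -> ~ S c ->
  (forall u v w, S u -> S v -> u <= w <= v -> S w) ->
  (exists2 y, S y & neg_orbit c f c y) ->
  exists n, [/\ (0 < n)%N, forall y, S y -> iter_defined c f n y,
    forall i y, (0 < i < n)%N -> S y -> ~ window (iter i f y) &
    forall y, S y -> window (iter n f y)].
Proof.
move=> SD Sc Sconv [y0 Sy0 y0c].
have S01 y : S y -> 0 <= y <= 1 by move=> /SD/window_future/future_range.
pose P n := `[< (0 < n)%N /\ exists y,
  [/\ S y, iter_defined c f n y & window (iter n f y)] >].
have exP : exists n, P n.
  have [n nd nc] := (neg_orbitP fB (S01 _ Sy0)).1 y0c.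
  exists n; apply/asboolP; split; last first.
    by exists y0; rewrite nc; split=> //; exact: c_window.
  by case: n nc {nd} => // y0E; case: Sc; rewrite -y0E.
have [n /asboolP[n0 [y1 [Sy1 ny1 y1D]]] nmin] := ex_minnP exP.
have out i y : (0 < i < n)%N -> S y -> iter_defined c f i y ->
    ~ window (iter i f y).
  move=> /andP[i0 iltn] Sy iy yD; have Pi : P i by apply/asboolP; split=> //; exists y.
  by have := nmin i Pi; rewrite leqNgt iltn.
have nS y : S y -> iter_defined c f n y.
  move=> Sy; suff : forall i, (i <= n)%N -> iter_defined c f i y by apply.
  elim=> [_|i IHi iltn]; first by apply/iter_definedP; split=> //; exact: S01.
  have iy := IHi (ltnW iltn); apply/iter_definedS; split=> // iyc.
  case: i iltn iy iyc {IHi} => [_ _ yc|i iltn iy iyc]; first by apply: Sc; rewrite -yc.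
  by apply: (out i.+1 y) => //; rewrite iyc; exact: c_window.
(* A point y1 of S returns to the window at time n; the image of the segment
   between y and y1 links the image of y to the window. *)
exists n; split=> // [i y iltn Sy|y Sy].
  by apply: out => //; apply: iter_defined_le (nS _ Sy); case/andP: iltn => _ /ltnW.
have F z : S z -> future (iter n f z).
  by move=> Sz; apply: future_iter; [exact/window_future/SD|exact: nS].
apply: (window_extend y1D) => z.
have [yy1|y1y|<-] := ltgtP y y1; last by rewrite minxx maxxx => /le_anti <-; exact: F.
- have [|lt ivt] := iter_segment fB yy1 (n := n).
    by move=> w yw; apply: nS; exact: (Sconv y y1).
  rewrite (min_r (ltW lt)) (max_l (ltW lt)) => /ivt[w yw <-].
  by apply: F; exact: (Sconv y y1).
- have [|lt ivt] := iter_segment fB y1y (n := n).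
    by move=> w yw; apply: nS; exact: (Sconv y1 y).
  rewrite (min_l (ltW lt)) (max_r (ltW lt)) => /ivt[w yw <-].
  by apply: F; exact: (Sconv y1 y).
Qed.

(** F stands for the filter of left or right neighborhoods of c, and l for f(c-)
    or f(c+).  Before time n the images of S stay away from a neighborhood of c,
    hence so does the lateral orbit. *)
Lemma lateral_return (F : set_system R) S l n : ProperFilter F ->
  (\forall y \near F, S y) -> f y @[y --> F] --> l -> future l ->
  (0 < n)%N -> (forall y, S y -> iter_defined c f n y) ->
  (forall i y, (0 < i < n)%N -> S y -> ~ window (iter i f y)) ->
  (forall y, S y -> window (iter n f y)) ->
  [/\ forall i, (i < n)%N -> iter_defined c f i l,
     forall i, (i < n)%N -> iter i.+1 f y @[y --> F] --> iter i f l &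
     window (iter n.-1 f l)].
Proof.
move=> PF FS fl lF n0 nS nD SD.
have F01 : \forall y \near F, 0 <= y <= 1 /\ y <> c.
  apply: filterS FS => y /nS/iter_definedP[y01 yc].
  by split=> //; exact: (yc 0%N).
have nl i : (i < n)%N -> iter_defined c f i l.
  elim: i => [_|i IHi iltn].
    by apply/iter_definedP; split=> //; exact: future_range.
  have il := IHi (ltnW iltn).
  apply/iter_definedS; split=> // ilc.
  have := cvg_iterS fB PF F01 fl il.
  rewrite ilc => /cvgrPdist_lt/(_ d d0) nearc.
  have [y [Sy]] := filter_ex (filterI FS nearc).
  by rewrite distrC => /near_window; exact: nD.
have nlim i : (i < n)%N -> iter i.+1 f y @[y --> F] --> iter i f l.
  by move=> /nl; exact: cvg_iterS F01 fl.
split=> //.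
have n1 : (n.-1 < n)%N by rewrite prednK.
apply: window_limit => [|e e0]; first by apply: future_iter => //; exact: nl.
have /cvgrPdist_lt/(_ e e0) := nlim _ n1; rewrite prednK// => nearl.
have [y [Sy yl]] := filter_ex (filterI FS nearl).
by exists (iter n f y); [exact: SD|rewrite distrC].
Qed.

Lemma avoids_c_invariant S n : (0 < n)%N ->
  (forall y, S y -> iter_defined c f n y /\ S (iter n f y)) ->
  forall y, S y -> avoids_c c f y.
Proof.
move=> n0 nS y Sy m.
suff [mn _] : iter_defined c f (m * n) y /\ S (iter (m * n) f y).
  by apply: iter_defined_le mn; rewrite leq_pmulr.
elim: m => [|m [mn Smn]].
  by have [ny _] := nS y Sy; split=> //; apply: iter_defined_le ny.
have [nmn Snmn] := nS _ Smn; rewrite mulSn; split; last by rewrite iterD.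
by rewrite addnC; exact: iter_definedD.
Qed.

(** The closure of such a set S is contained in [future]. *)
Definition enclosed S := exists E, [/\ closed E, E `<=` future & S `<=` E].

Lemma enclosedU S T : enclosed S -> enclosed T -> enclosed (S `|` T).
Proof.
move=> [E [cE Ef SE]] [E' [cE' E'f TE']]; exists (E `|` E'); split.
- exact: closedU.
- by move=> x [/Ef|/E'f].
- exact: setUSS.
Qed.

Lemma enclosed_bigcup (S : nat -> set R) n :
  (forall i, (i < n)%N -> enclosed (S i)) -> enclosed (\bigcup_(i in `I_n) S i).
Proof.
elim: n => [_|n IHn Sn]; last first.
  rewrite IIS bigcup_setU bigcup_set1; apply: enclosedU; last exact: Sn.
  by apply: IHn => i /ltnW; exact: Sn.
by exists set0; split; [exact: closed0|exact: sub0set|rewrite II0 bigcup_set0].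
Qed.

(** K stands for a segment with end c in the window.  Its image without the end
    is completed to a compact set by the lateral value at c, which also belongs
    to [future]. *)
Lemma enclosed_piece (F : set_system R) (K : set R) l n i : ProperFilter F -> compact K ->
  K `<=` window -> future l ->
  (forall P : set R, F P -> \forall z \near c, K z -> z <> c -> P z) ->
  (forall y, K y -> y <> c -> iter_defined c f n y) ->
  (forall i, (i < n)%N -> iter_defined c f i l) ->
  (forall i, (i < n)%N -> iter i.+1 f y @[y --> F] --> iter i f l) ->
  (i < n)%N -> enclosed (iter i f @` (K `\ c)).
Proof.
move=> PF cK KD lF FK nK nl nlim.
case: i => [|i] iltn.
  exists K; split; first exact: (compact_closed (@Rhausdorff R)).
    by move=> y /KD/window_future.
  by move=> _ [y [Ky _] <-].
pose phi y := if y == c then iter i f l else iter i.+1 f y.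
exists (phi @` K); split.
- apply: (compact_closed (@Rhausdorff R)); apply: continuous_compact => //.
  apply/subspace_continuousP => x Kx; apply/cvgrPdist_lt => e e0.
  suff : \forall z \near x, K z -> `|phi x - phi z| < e by [].
  have [xc|/eqP xc] := eqVneq x c.
    have /cvgrPdist_lt/(_ e e0)/FK := nlim i (ltnW iltn).
    rewrite -xc; apply: filterS => z zP Kz; rewrite /phi xc eqxx.
    case: (eqVneq z c) => [_|/eqP zc]; first by rewrite subrr normr0.
    by apply: zP; rewrite // xc.
  have ix := iter_defined_le (ltnW iltn) (nK x Kx xc).
  have [d' d'0 id'] := iter_continuous fB ix e0.
  have := nbhsx_ballx x d' d'0; apply: filterS => z xz Kz.
  have z01 : 0 <= z <= 1 by exact/future_range/window_future/KD.
  have [|iz zx] := id' z z01; first by rewrite distrC; exact: xz.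
  have zc : z <> c by exact: (iz.2 0%N isT).
  by rewrite /phi (introF eqP xc) (introF eqP zc) distrC.
- move=> _ [y Ky <-]; rewrite /phi; case: (eqVneq y c) => [_|/eqP yc].
    by apply: future_iter => //; apply: nl; exact: ltnW.
  apply: future_iter; first exact/window_future/KD.
  by apply: iter_defined_le (ltnW iltn) (nK y Ky yc).
- move=> _ [y [Ky yc] <-]; exists y => //.
  by rewrite /phi; case: (eqVneq y c).
Qed.

(** If the return map f^n moved y to the left, the part of the window to
    the left of y would be invariant under it and would avoid c forever, against
    the density of the preimages of c.  The bound h is the return of c-. *)
Lemma left_return : exists n h, [/\ (0 < n)%N, window h,
  exists2 i, iter_defined c f i (iter_cm c f 1) & iter i f (iter_cm c f 1) = h,
  forall y, window y -> y < c ->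
    [/\ window (iter n f y), y <= iter n f y & iter n f y <= h] &
  forall p i, window p -> p < c -> (i < n)%N ->
    enclosed (iter i f @` [set y | p <= y < c])].
Proof.
have /andP[c0 c1] := branch_c fB.
pose S := [set y | window y /\ y < c].
have near_S : \forall y \near c^'-, S y.
  near=> y; have yc : y < c by near: y; exact: nbhs_left_lt.
  split=> //; apply: near_window; rewrite ltr0_norm ?subr_lt0// opprB.
  by near: y; apply: nbhs_left_ltBl.
have [||||n [n0 nS nD SD]] := @first_return S.
- by move=> y [].
- by move=> []; rewrite ltxx.
- move=> u v w [uD uc] [vD vc] /andP[uw wv]; split; last exact: le_lt_trans vc.
  by apply: (window_hull uD vD); rewrite uw.
- have [y [yD yc]] := @filter_ex _ _ (at_left_proper_filter c) _ near_S.
  have /andP[y0 _] := future_range (window_future yD).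
  have [z /andP[yz zc] zneg] := dense_c y0 yc (ltW c1); exists z => //; split=> //.
  by apply: (window_hull yD c_window); rewrite !ltW.
have [nl nlim hD] := lateral_return (at_left_proper_filter c) near_S
  (cvg_iter_cm1 fB) future_cm n0 nS nD SD.
exists n, (iter n.-1 f (iter_cm c f 1)); split=> // [|y yD yc|p i pD pc iltn].
    by exists n.-1 => //; apply: nl; rewrite prednK.
  split; first exact: SD.
  - rewrite leNgt; apply/negP => gy.
    have /andP[gy0 _] := future_range (window_future (SD y (conj yD yc))).
    have /andP[_ y1] := future_range (window_future yD).
    have [z /andP[gyz zy] zneg] := dense_c gy0 gy y1.
    have Sz : S z.
      split; last exact: lt_trans yc.
      by apply: (window_hull (SD y (conj yD yc)) yD); rewrite !ltW.
    have := @avoids_c_invariant [set w | S w /\ w < y] n n0 _ z.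
    have z01 := future_range (window_future Sz.1).
    move=> zavoid; apply: ((avoids_cP fB z01).1 (zavoid _ _)) => //.
    move=> w [Sw wy]; split; first exact: nS.
    have [|ltw _] := iter_segment fB wy (n := n).
      move=> t /andP[wt ty]; apply: nS; split; last exact: le_lt_trans yc.
      by apply: (window_hull Sw.1 yD); rewrite wt.
    have wly := lt_trans ltw gy; split=> //; split; first exact: SD.
    exact: lt_trans yc.
  - have := nlim n.-1; rewrite prednK// => /(_ (leqnn n)) lim_h.
    apply: (cvgr_to_ge lim_h); near=> z.
    have yz : y < z by near: z; exact: nbhs_left_gt.
    have Sz : S z by near: z.
    apply: ltW; have [|//] := iter_segment fB yz (n := n).
    move=> t /andP[yt tz]; apply: nS; split; last exact: le_lt_trans Sz.2.
    by apply: (window_hull yD Sz.1); rewrite yt.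
have KE : [set y | p <= y < c] = `[p, c] `\ c.
  apply/seteqP; split=> y; rewrite /= in_itv/=.
    by move=> /andP[py yc]; rewrite py (ltW yc); split=> // ycE; rewrite ycE ltxx in yc.
  by move=> [/andP[py yc] ycE]; rewrite py lt_neqAle yc andbT; apply/eqP.
rewrite KE; apply: (enclosed_piece (l := iter_cm c f 1) (F := c^'-) (n := n)) => //.
- exact: segment_compact.
- by move=> y; rewrite /= in_itv/=; exact: window_hull pD c_window.
- exact: future_cm.
- move=> P PF; have : \forall z \near c, z < c -> P z by exact: PF.
  apply: filterS => z zP; rewrite /= in_itv/= => /andP[_ zc] znc.
  by apply: zP; rewrite lt_neqAle zc andbT; apply/eqP.
- move=> y; rewrite /= in_itv/= => /andP[py yc] ync; apply: nS; split.
    by apply: (window_hull pD c_window); rewrite py.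
  by rewrite lt_neqAle yc andbT; apply/eqP.
Unshelve. all: by end_near. Qed.

(** The mirror image of [left_return]. *)
Lemma right_return : exists n h, [/\ (0 < n)%N, window h,
  exists2 i, iter_defined c f i (iter_cp c f 1) & iter i f (iter_cp c f 1) = h,
  forall y, window y -> c < y ->
    [/\ window (iter n f y), iter n f y <= y & h <= iter n f y] &
  forall q i, window q -> c < q -> (i < n)%N ->
    enclosed (iter i f @` [set y | c < y <= q])].
Proof.
have /andP[c0 c1] := branch_c fB.
pose S := [set y | window y /\ c < y].
have near_S : \forall y \near c^'+, S y.
  near=> y; have cy : c < y by near: y; exact: nbhs_right_gt.
  split=> //; apply: near_window; rewrite gtr0_norm ?subr_gt0//.
  by near: y; apply: nbhs_right_ltDr.
have [||||n [n0 nS nD SD]] := @first_return S.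
- by move=> y [].
- by move=> []; rewrite ltxx.
- move=> u v w [uD cu] [vD cv] /andP[uw wv]; split; last exact: lt_le_trans uw.
  by apply: (window_hull uD vD); rewrite uw.
- have [y [yD cy]] := @filter_ex _ _ (at_right_proper_filter c) _ near_S.
  have /andP[_ y1] := future_range (window_future yD).
  have [z /andP[cz zy] zneg] := dense_c (ltW c0) cy y1; exists z => //; split=> //.
  by apply: (window_hull c_window yD); rewrite !ltW.
have [nl nlim hD] := lateral_return (at_right_proper_filter c) near_S
  (cvg_iter_cp1 fB) future_cp n0 nS nD SD.
exists n, (iter n.-1 f (iter_cp c f 1)); split=> // [|y yD cy|q i qD cq iltn].
    by exists n.-1 => //; apply: nl; rewrite prednK.
  split; first exact: SD.
  - rewrite leNgt; apply/negP => gy.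
    have /andP[_ gy1] := future_range (window_future (SD y (conj yD cy))).
    have /andP[y0 _] := future_range (window_future yD).
    have [z /andP[yz zgy] zneg] := dense_c y0 gy gy1.
    have Sz : S z.
      split; last exact: lt_trans yz.
      by apply: (window_hull yD (SD y (conj yD cy))); rewrite !ltW.
    have := @avoids_c_invariant [set w | S w /\ y < w] n n0 _ z.
    have z01 := future_range (window_future Sz.1).
    move=> zavoid; apply: ((avoids_cP fB z01).1 (zavoid _ _)) => //.
    move=> w [Sw yw]; split; first exact: nS.
    have [|ltw _] := iter_segment fB yw (n := n).
      move=> t /andP[yt tw]; apply: nS; split; last exact: lt_le_trans yt.
      by apply: (window_hull yD Sw.1); rewrite yt.
    have wly := lt_trans gy ltw; split=> //; split; first exact: SD.
    exact: lt_trans wly.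
  - have := nlim n.-1; rewrite prednK// => /(_ (leqnn n)) lim_h.
    apply: (cvgr_to_le lim_h); near=> z.
    have zy : z < y by near: z; exact: nbhs_right_lt.
    have Sz : S z by near: z.
    apply: ltW; have [|//] := iter_segment fB zy (n := n).
    move=> t /andP[zt ty]; apply: nS; split; last exact: lt_le_trans Sz.2 _.
    by apply: (window_hull Sz.1 yD); rewrite zt.
have KE : [set y | c < y <= q] = `[c, q] `\ c.
  apply/seteqP; split=> y; rewrite /= in_itv/=.
    by move=> /andP[cy yq]; rewrite yq (ltW cy); split=> // ycE; rewrite ycE ltxx in cy.
  by move=> [/andP[cy yq] ycE]; rewrite yq lt_neqAle cy !andbT eq_sym; apply/eqP.
rewrite KE; apply: (enclosed_piece (l := iter_cp c f 1) (F := c^'+) (n := n)) => //.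
- exact: segment_compact.
- by move=> y; rewrite /= in_itv/=; exact: window_hull c_window qD.
- exact: future_cp.
- move=> P PF; have : \forall z \near c, c < z -> P z by exact: PF.
  apply: filterS => z zP; rewrite /= in_itv/= => /andP[cz _] znc.
  by apply: zP; rewrite lt_neqAle cz andbT eq_sym; apply/eqP.
- move=> y; rewrite /= in_itv/= => /andP[cy yq] ync; apply: nS; split.
    by apply: (window_hull c_window qD); rewrite cy.
  by rewrite lt_neqAle cy andbT eq_sym; apply/eqP.
Unshelve. all: by end_near. Qed.

(** Let p be the minimum of u, of the return of c+, and of a point of the window to
    the left of c, and define q symmetrically.  A return from the left half
    never moves a point to the left, nor beyond the return of c-; a return from the
    right half behaves symmetrically.  So all visits of the orbit to the window
    take place in [p, q], and between two visits the orbit runs through finitely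
    many images of [p, c[ and ]c, q]. *)
Lemma window_trap u : window u -> avoids_c c f u ->
  enclosed (range (fun j => iter j f u)).
Proof.
move=> uD uc.
have d2 : 0 < d / 2 < d by rewrite divr_gt0//= ltr_pdivrMr// ltr_pMr// ltr1n.
have /andP[d20 d2d] := d2.
have [n [h [n0 hD _ nret nenc]]] := left_return.
have [m [k [m0 kD _ mret menc]]] := right_return.
pose p := Num.min (Num.min u k) (c - d / 2).
pose q := Num.max (Num.max u h) (c + d / 2).
have wmin a b : window a -> window b -> window (Num.min a b) by case: leP.
have wmax a b : window a -> window b -> window (Num.max a b) by case: leP.
have pD : window p.
  apply: (wmin _ _ (wmin _ _ uD kD)); apply: near_window.
  by rewrite addrAC subrr add0r normrN gtr0_norm.
have qD : window q.
  apply: (wmax _ _ (wmax _ _ uD hD)); apply: near_window.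
  by rewrite addrAC subrr add0r gtr0_norm.
have pc : p < c by rewrite !gt_min ltrBlDr ltrDl d20 !orbT.
have cq : c < q by rewrite !lt_max ltrDl d20 !orbT.
have [pu pk] : p <= u /\ p <= k by split; rewrite !ge_min lexx ?orbT.
have [uq hq] : u <= q /\ h <= q by split; rewrite !le_max lexx ?orbT.
pose L := \bigcup_(i in `I_n) (iter i f @` [set y | p <= y < c]).
pose M := \bigcup_(i in `I_m) (iter i f @` [set y | c < y <= q]).
(* w is the last visit of the orbit to the window before time j, and i is the
   time elapsed since then. *)
have visit j : exists w i, [/\ iter i f w = iter j f u, p <= w <= q &
    (w < c) && (i < n)%N || (c < w) && (i < m)%N].
  elim: j => [|j [w [i [wi /andP[pw wq] wlr]]]].
    exists u, 0%N; rewrite pu uq n0 m0 !andbT; split=> //.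
    by rewrite -neq_lt; apply/eqP; exact: (uc 1%N).2 0%N isT.
  have wD : window w by apply: (window_hull pD qD); rewrite pw.
  have jc : iter j.+1 f u <> c by have /iter_definedS[] := uc j.+2.
  have wiS : iter i.+1 f w = iter j.+1 f u by rewrite /= wi.
  case/orP: wlr => /andP[wc iltn].
    have [ilt|] := ltnP i.+1 n; first by exists w, i.+1; rewrite pw wq wc ilt.
    move=> nlei; have {iltn nlei} iE : i.+1 = n by apply/eqP; rewrite eqn_leq iltn.
    have [gD yg gh] := nret w wD wc.
    exists (iter n f w), 0%N; rewrite (le_trans pw yg) (le_trans gh hq) n0 m0 !andbT.
    by rewrite -neq_lt -iE wiS; split=> //; apply/eqP.
  have [ilt|] := ltnP i.+1 m; first by exists w, i.+1; rewrite pw wq wc ilt orbT.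
  move=> nlei; have {iltn nlei} iE : i.+1 = m by apply/eqP; rewrite eqn_leq iltn.
  have [gD gy kg] := mret w wD wc.
  exists (iter m f w), 0%N; rewrite (le_trans pk kg) (le_trans gy wq) n0 m0 !andbT.
  by rewrite -neq_lt -iE wiS; split=> //; apply/eqP.
have [E [cE EF LME]] : enclosed (L `|` M).
  apply: enclosedU; apply: enclosed_bigcup => i; first exact: nenc.
  exact: menc.
exists E; split=> // _ [j _ <-]; apply: LME.
have [w [i [<- /andP[pw wq] /orP[/andP[wc iltn]|/andP[cw iltm]]]]] := visit j.
  by left; exists i => //; exists w; rewrite //= pw.
by right; exists i => //; exists w; rewrite //= cw.
Qed.

End window.
Arguments future {R} c f d.
Arguments window {R} c f d.
Arguments enclosed {R} c f d.

(** * The attractor is reached from each neighborhood of the critical point *)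

Section attractor.
Context {R : realType} {c : R} {f : R -> R} {d : R}.
Hypothesis fB : increasing_branches c f.
Hypothesis dense_c : forall x y, 0 <= x -> x < y -> y <= 1 ->
  exists2 z, x < z < y & neg_orbit c f c z.
Hypothesis d0 : 0 < d.
Hypothesis d01 : forall x, `|x - c| < d -> 0 <= x <= 1.
Implicit Types (x y z w : R) (S : set R).

(** Up to finitely many points, S is enclosed in [future].  The finite part takes
    care of the time before an orbit enters the window. *)
Definition tame S := exists X E,
  [/\ finite_set X, closed E, E `<=` future c f d & S `<=` X `|` E].

Lemma tameU S T : tame S -> tame T -> tame (S `|` T).
Proof.
move=> [X [E [fX cE Ef SE]]] [X' [E' [fX' cE' E'f TE']]].
exists (X `|` X'), (E `|` E'); split.
- by rewrite finite_setU.
- exact: closedU.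
- by move=> x [/Ef|/E'f].
- by rewrite setUACA; exact: setUSS.
Qed.

Lemma tame_sub S T : S `<=` T -> tame T -> tame S.
Proof. by move=> ST [X [E [fX cE Ef TE]]]; exists X, E; split=> // x /ST/TE. Qed.

Lemma tame_finite S : finite_set S -> tame S.
Proof.
move=> fS; exists S, set0; split; [exact: fS|exact: closed0|exact: sub0set|].
by rewrite setU0.
Qed.

Lemma finite_set_closed S : finite_set S -> closed S.
Proof.
move=> fS; have /accessible_finite_set_closed := hausdorff_accessible (@Rhausdorff R).
exact.
Qed.

(** The points of the closure of S in [future] are those in the closed set E and
    some of the finitely many points of X. *)
Lemma tame_closed S : tame S -> closed (closure S `&` future c f d).
Proof.
move=> [X [E [fX cE Ef SE]]].
have SXE : closure S `<=` X `|` E.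
  rewrite [in X in _ `<=` X](closure_id (X `|` E)).1; first exact: closureS.
  by apply: closedU => //; exact: finite_set_closed.
have -> : closure S `&` future c f d =
    closure S `&` ((X `&` future c f d) `|` E).
  apply/seteqP; split=> x [Sx]; last by case=> [[]|/Ef].
  by case: (SXE x Sx) => [Xx xF|Ex _]; split=> //; [left|right].
apply: closedI; first exact: closed_closure.
apply: closedU => //; apply: finite_set_closed; exact: finite_setIl.
Qed.

(** After its entry into the window the orbit is enclosed by [window_trap], unless
    it reaches c, in which case it stops after finitely many steps. *)
Lemma orbit_tame w i : iter_defined c f i w -> window c f d (iter i f w) ->
  tame [set iter j f w | j in [set j | forall i, (i < j)%N -> iter i f w <> c]].
Proof.
move=> iw iwD; have w01 : 0 <= w <= 1 by have /iter_definedP[] := iw.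
have [wc|nwc] := pselect (avoids_c c f w).
  have [E [cE Ef iE]] := window_trap fB dense_c d0 d01 iwD (avoids_c_iter fB i wc).
  exists ((fun j => iter j f w) @` `I_i), E; split=> //.
    exact/finite_image/finite_II.
  move=> _ [j _ <-]; have [ji|ij] := ltnP j i; first by left; exists j.
  by right; apply: iE; exists (j - i)%N => //; rewrite -iterD subnK.
have [n _ nc] : exists2 n, iter_defined c f n w & iter n f w = c.
  by apply/(neg_orbitP fB w01); apply: contrapT => /(avoids_cP fB w01).
apply: tame_finite; apply: (@sub_finite_set _ _ ((fun j => iter j f w) @` `I_n.+1)).
  move=> _ [j jc <-]; exists j => //=; rewrite ltnS leqNgt; apply/negP => nj.
  exact: jc nj nc.
exact/finite_image/finite_II.
Qed.

Lemma pos_orbit_tame t : 0 <= t <= 1 -> closure (pos_orbit c f t) c ->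
  tame (pos_orbit c f t).
Proof.
move=> t01 tc; apply: tameU.
  have [i [it itD]] : exists i, iter_defined c f i t /\ window c f d (iter i f t).
    have [tav|ntav] := pselect (avoids_c c f t); last first.
      have [n nt nc] : exists2 n, iter_defined c f n t & iter n f t = c.
        by apply/(neg_orbitP fB t01); apply: contrapT => /(avoids_cP fB t01).
      by exists n; split=> //; rewrite nc; exact: c_window.
    have [y [ty cy]] := tc _ (nbhsx_ballx c d d0).
    move: ty; rewrite pos_orbit_avoids_c// => -[j _ jy].
    exists j; split; first exact: tav.
    by apply: near_window => //; rewrite jy distrC.
  exact: orbit_tame it itD.
have [n [h [_ hD [i il ih] _ _]]] := left_return fB dense_c d0 d01.
have [m [k [_ kD [j jl jk] _ _]]] := right_return fB dense_c d0 d01.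
have cmT : tame (lateral_orbit c (iter_cm c f)).
  apply: tame_sub (lateral_orbit_sub (iter_cm1_range fB) iter_cm0 (iter_cmS fB)) _.
  apply: tameU; first exact/tame_finite/finite_set1.
  by apply: (orbit_tame il); rewrite ih.
have cpT : tame (lateral_orbit c (iter_cp c f)).
  apply: tame_sub (lateral_orbit_sub (iter_cp1_range fB) iter_cp0 (iter_cpS fB)) _.
  apply: tameU; first exact/tame_finite/finite_set1.
  by apply: (orbit_tame jl); rewrite jk.
by apply: tame_sub (tameU cmT cpT) => y [].
Qed.

Lemma pos_orbit_forward t w : pos_orbit c f t w -> w <> c ->
  pos_orbit c f t (f w).
Proof.
move=> [[j jc <-]|[tc wl]] wc; last first.
  right; split=> //; case: wl => wl; [left|right].
    exact: lateral_orbit_forward (iter_cm1_range fB) iter_cm0 (iter_cmS fB) _ wl wc.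
  exact: lateral_orbit_forward (iter_cp1_range fB) iter_cp0 (iter_cpS fB) _ wl wc.
left; exists j.+1 => // i; rewrite ltnS leq_eqVlt => /orP[/eqP->//|]; exact: jc.
Qed.

Lemma closure_pos_orbit_forward t : closure (pos_orbit c f t) `<=` `[0, 1] ->
  forward_invariant c f (closure (pos_orbit c f t)).
Proof.
move=> t01 x tx xc; have x01 : 0 <= x <= 1 by have := t01 x tx; rewrite /= in_itv.
move=> B /nbhs_ballP[e /= e0 eB].
have [d' d'0 fd'] := branch_continuous fB x01 xc e0.
have m0 : 0 < Num.min d' `|x - c|.
  by rewrite lt_min d'0 normr_gt0 subr_eq0; exact/eqP.
have [y [ty]] := tx _ (nbhsx_ballx x _ m0).
rewrite /ball/= lt_min => /andP[xyd xyc].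
have y01 : 0 <= y <= 1.
  by have := t01 y (subset_closure ty); rewrite /= in_itv.
exists (f y); split; last first.
  by apply: eB; rewrite /ball/= distrC; apply: fd' => //; rewrite distrC.
by apply: pos_orbit_forward => // yc; rewrite yc ltxx in xyc.
Qed.

Lemma residual_recurrent (B : set R) : residual_in_open B ->
  exists y, [/\ B y, avoids_c c f y & cluster (iter n f y @[n --> \oo]) c].
Proof.
move=> [U [oU U0 U01 UB]].
have [|y [_ By yc cy]] := recurrent_point fB oU U0 U01 _ UB; last by exists y.
move=> x y xy xyU.
have /andP[x0 _] : 0 <= x <= 1.
  by have := U01 x; rewrite /= in_itv; apply; apply: xyU; rewrite /= in_itv/= lexx ltW.
have /andP[_ y1] : 0 <= y <= 1.
  by have := U01 y; rewrite /= in_itv; apply; apply: xyU; rewrite /= in_itv/= lexx ltW.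
exact: dense_c.
Qed.

(** The intersection of L with [future] is closed and forward invariant.  If it
    were a proper subset of L, minimality would give a point y whose
    omega-limit set is contained in L but not in [future], and which is
    recurrent to c.  But the orbit of y enters the window, and then
    [window_trap] keeps its omega-limit set in [future]. *)
Lemma attractor_future L : topological_attractor c f L -> transitive_set c f L ->
  L `<=` future c f d.
Proof.
move=> [_ L01 Lbasin Lmin] [t Lt tL] x Lx; apply: contrapT => nxF.
have Lc : L c.
  have [y [[_ yL] yc cy]] := residual_recurrent Lbasin.
  by apply: yL; rewrite omega_avoids_c.
have t01 : 0 <= t <= 1 by have := L01 t Lt; rewrite /= in_itv.
have cLF : closed (L `&` future c f d).
  by rewrite -tL; apply: tame_closed; apply: pos_orbit_tame; rewrite ?tL.
have fLF : forward_invariant c f (L `&` future c f d).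
  move=> y [Ly yF] yc; split; last first.
    apply: future_f => //; apply/domP; split=> //.
    by have := L01 y Ly; rewrite /= in_itv.
  by rewrite -tL in L01 Ly *; exact: closure_pos_orbit_forward.
have LFL : L `&` future c f d `<` L.
  by split; [exact: subIsetl|move=> /(_ x Lx)[]].
have [y [[[ydom yL] nyF] yc cy]] := residual_recurrent (Lmin _ cLF fLF LFL).
apply: nyF; split=> // w wy; split; first exact: yL.
move: wy; rewrite omega_avoids_c// => /cluster_eventuallyP wy.
move/cluster_eventuallyP : cy => /(_ (d / 2) 0%N)[|j _ cj]; first by rewrite divr_gt0.
have jD : window c f d (iter j f y).
  by apply: near_window; rewrite // distrC (le_lt_trans cj)// gtr_pMr// invf_lt1// ltr1n.
have [E [cE Ef jE]] := window_trap fB dense_c d0 d01 jD (avoids_c_iter fB j yc).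
apply: Ef; apply: cE => B /nbhs_ballP[e /= e0 eB].
have [|n jn wn] := wy (e / 2) j; first by rewrite divr_gt0.
exists (iter n f y); split.
  by apply: jE; exists (n - j)%N => //; rewrite -iterD subnK.
by apply: eB; rewrite /ball/= (le_lt_trans wn)// gtr_pMr// invf_lt1// ltr1n.
Qed.

End attractor.

(** * The alpha-limit sets *)

Section main.
Context {R : realType} {c : R} {f : R -> R}.

Lemma derivable_within_near (A : set R) (g : R -> R) (x : R) : A x ->
  derivable_within A g x ->
  forall e : R, 0 < e -> exists2 d : R, 0 < d &
    forall y, A y -> `|y - x| < d -> `|g y - g x| < e.
Proof.
move=> Ax /cvgrPdist_lt/(_ 1 ltr01); set l := lim _ => gl e e0.
have : \forall y \near x, y != x -> A y -> `|l - diffq g x y| < 1 by exact: gl.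
move=> /nbhs_ballP[d /= d0 dl].
have l1 : 0 < `|l| + 1 by rewrite ltr_wpDl.
exists (Num.min d (e / (`|l| + 1))); first by rewrite lt_min d0 divr_gt0.
move=> y Ay; rewrite lt_min => /andP[yd ye].
have [->|yx] := eqVneq y x; first by rewrite subrr normr0.
have := dl y; rewrite /ball/= distrC => /(_ yd yx Ay) ly.
have yx0 : 0 < `|y - x| by rewrite normr_gt0 subr_eq0.
have -> : g y - g x = diffq g x y * (y - x).
  by rewrite /diffq mulfVK// subr_eq0.
rewrite normrM; apply: (@le_lt_trans _ _ ((`|l| + 1) * `|y - x|)).
  rewrite ler_wpM2r//; have := ler_distD l (diffq g x y) 0.
  by rewrite !subr0 distrC addrC => /le_trans; apply; rewrite lerD2l ltW.
by rewrite mulrC -ltr_pdivlMr.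
Qed.

(** Monotonicity is read off from the normal form of a non-flat map, continuity
    from differentiability. *)
Lemma lorenz_increasing_branches : lorenz_map c f -> non_flat c f ->
  increasing_branches c f.
Proof.
move=> [c01 f01 [f1 _ _] _ _].
move=> [alpha [beta [a [b [phi0 [phi1 [[a1 b1] _ [D0 D1] fl fr]]]]]]].
have /andP[c0 c1] := c01.
split=> //.
- move=> x x01 xc; have := f01 x; rewrite /= in_itv/=; apply.
  by apply/domP.
- move=> x y x0 xy yc; rewrite !fl ?x0 ?(ltW (le_lt_trans x0 xy)) ?(lt_trans xy)//.
  have [_ [h [_ phi0r _ _ _]] phi0i] := D0.
  have I z : 0 <= z -> z < c -> `[0, c]%classic (c - z).
    by move=> z0 zc; rewrite /= in_itv/=; apply/andP; split; lra.
  have y0 := ltW (le_lt_trans x0 xy); have xc := lt_trans xy yc.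
  have P z : 0 <= z -> z < c -> 0 <= phi0 (c - z).
    by move=> z0 zc; have := phi0r _ (I z z0 zc); rewrite /= in_itv/= => /andP[].
  rewrite ltrD2l ltrN2; apply: gt0_ltr_powR; rewrite ?nnegrE ?P//.
    exact: lt_trans a1.
  by apply: phi0i; [exact: I|exact: I|lra].
- move=> x y cx xy y1; rewrite !fr ?y1 ?cx ?(lt_trans cx xy) ?(ltW (lt_le_trans xy y1))//.
  have [_ [h [_ phi1r _ _ _]] phi1i] := D1.
  have I z : c < z -> z <= 1 -> `[c, 1]%classic z.
    by move=> cz z1; rewrite /= in_itv/= ltW.
  have x1 := ltW (lt_le_trans xy y1); have cy := lt_trans cx xy.
  have P z : c < z -> z <= 1 -> 0 <= phi1 z.
    by move=> cz z1; have := phi1r _ (I z cz z1); rewrite /= in_itv/= => /andP[].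
  rewrite ltrD2l; apply: gt0_ltr_powR; rewrite ?nnegrE ?P//.
    exact: lt_trans b1.
  by apply: phi1i; [exact: I|exact: I|].
- move=> x x01 xc e e0.
  have Ax : dom c x by apply/domP.
  have [d d0 xd] := derivable_within_near Ax (f1 x Ax) e0.
  exists (Num.min d `|x - c|).
    by rewrite lt_min d0 normr_gt0 subr_eq0; exact/eqP.
  move=> y y01; rewrite lt_min => /andP[yd yc]; apply: xd => //.
  apply/domP; split=> // ycE; by rewrite ycE distrC ltxx in yc.
Qed.

(** Infinitely many of the preimages of x that accumulate at the midpoint of
    [a, b] lie in I, with times tending to infinity; two of them contradict the
    disjointness of the images of I. *)
Lemma alpha_limit_all_no_wandering (L : set R) : increasing_branches c f ->
  L !=set0 -> (forall x, L x -> alpha_limit c f x = `[0, 1]%classic) ->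
  ~ exists I, wandering_interval c f I.
Proof.
move=> fB [x Lx] Lalpha [I [Iint [a [b [Ia Ib ab]]] Ih Idisj _]].
have seg z : a <= z <= b -> I z by move=> azb; exact: (Iint a b).
have I01 z : I z -> 0 <= z <= 1.
  by move=> Iz; have [/(_ z Iz)/iter_definedP[]] := Ih 1%N isT.
have : `[0, 1]%classic ((a + b) / 2).
  by rewrite /= in_itv/=; apply: I01; apply: seg; rewrite !midf_le ?ltW.
rewrite -(Lalpha x Lx) => -[n [u [ninf un uy]]].
have /near_in_itvoo/uy [N _ Nu] : (a + b) / 2 \in `]a, b[.
  by rewrite in_itv/= !midf_lt.
have un_orbit j : (N <= j)%N -> I (u j) /\ iter (n j) f (u j) = x.
  move=> Nj; have Iu : I (u j).
    by apply: seg; have := Nu j Nj; rewrite /= in_itv/= => /andP[/ltW-> /ltW->].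
  split=> //; apply: (npreim_orbit (un j)) => i ij.
  by have [/(_ _ Iu)/iter_definedS[]] := Ih i.+1 isT.
have [M1 _ Mn1] := (cvgnyPge _).1 ninf 1%N.
pose j := maxn N M1.
have [M2 _ Mn2] := (cvgnyPge _).1 ninf (n j).+1.
pose k := maxn N M2.
have [Iuj jx] := un_orbit j (leq_maxl _ _).
have [Iuk kx] := un_orbit k (leq_maxl _ _).
have nj : (0 < n j)%N by apply: Mn1; rewrite /= leq_maxr.
have nk : (n j < n k)%N by apply: Mn2; rewrite /= leq_maxr.
have : ((iter (n j) f @` I) `&` (iter (n k) f @` I)) x.
  by split; [exists (u j)|exists (u k)].
rewrite Idisj// ?(leq_ltn_trans _ nk)// => njk.
by rewrite njk ltnn in nk.
Qed.

(** Near y there is a segment around a preimage z of c, with a time n as large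
    as desired, on which f^n is increasing.  Its image is a neighborhood of c,
    so it contains a preimage of x, and this one pulls back to the segment. *)
Lemma no_wandering_alpha_limit_all (L : set R) : increasing_branches c f ->
  L `<=` `[0, 1] ->
  (forall x y, 0 <= x -> x < y -> y <= 1 ->
     exists2 z, x < z < y & neg_orbit c f c z) ->
  (forall d, 0 < d -> (forall x, `|x - c| < d -> 0 <= x <= 1) ->
     L `<=` future c f d) ->
  forall x, L x -> alpha_limit c f x = `[0, 1]%classic.
Proof.
move=> fB L01 dense_c Lfuture x Lx.
have x01 : 0 <= x <= 1 by have := L01 x Lx; rewrite /= in_itv.
have /andP[c0 c1] := branch_c fB.
have approx y e N : 0 <= y <= 1 -> 0 < e -> exists n u,
    [/\ (N <= n)%N, npreim c f n x u & `|u - y| <= e].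
  move=> /andP[y0 y1] e0.
  have ab : Num.max 0 (y - e) < Num.min 1 (y + e).
    by rewrite gt_max !lt_min; apply/andP; split; apply/andP; split; lra.
  have [||x' [y' [ax' x'y' y'b x'y'N]]] := @shrink_defined _ _ _ fB N _ _ _ ab.
  - by rewrite le_max lexx.
  - by rewrite ge_min lexx.
  have [x'0 x'e] : 0 <= x' /\ y - e <= x' by move: ax'; rewrite ge_max => /andP[].
  have [y'1 y'e] : y' <= 1 /\ y' <= y + e by move: y'b; rewrite le_min => /andP[].
  have [z /andP[x'z zy'] zneg] := dense_c _ _ x'0 x'y' y'1.
  have z01 : 0 <= z <= 1 by rewrite (le_trans x'0 (ltW x'z)) (le_trans (ltW zy')).
  have [n zn znc] := (neg_orbitP fB z01).1 zneg.
  have Nn : (N <= n)%N.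
    rewrite leqNgt; apply/negP => nN; apply: (x'y'N z _).2 nN znc.
    by rewrite !ltW.
  have [r r0 zr] := iter_continuous fB zn ltr01.
  pose s := Num.max x' (z - r / 2); pose t := Num.min y' (z + r / 2).
  have [x's sz] : x' <= s /\ s < z.
    by rewrite le_max lexx gt_max x'z/=; split=> //; lra.
  have [ty' zt] : t <= y' /\ z < t.
    by rewrite ge_min lexx lt_min zy'/=; split=> //; lra.
  have st_defined w : s <= w <= t -> iter_defined c f n w.
    move=> /andP[sw wt]; apply: (zr w _ _).1.
      by rewrite (le_trans x'0 (le_trans x's sw)) (le_trans wt (le_trans ty' y'1)).
    move: sw wt; rewrite ge_max le_min => /andP[_ sw] /andP[_ wt].
    by rewrite ltr_norml; apply/andP; split; lra.
  have [|sc _] := iter_segment fB sz (n := n).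
    by move=> w /andP[sw wz]; apply: st_defined; rewrite sw (le_trans wz)// ltW.
  have [|ct _] := iter_segment fB zt (n := n).
    by move=> w /andP[zw wt]; apply: st_defined; rewrite wt (le_trans (ltW sz)).
  have [|_ ivt] := iter_segment fB (lt_trans sz zt) (n := n); first exact: st_defined.
  rewrite znc in sc ct.
  (* The d-neighborhood of c lies in [0,1] and is covered by the image of
     [s, t]. *)
  pose d := Num.min (Num.min c (1 - c)) (Num.min (c - iter n f s) (iter n f t - c)).
  have d0 : 0 < d by rewrite !lt_min c0 !subr_gt0 c1 sc.
  have dP w : `|w - c| < d -> 0 <= w <= 1 /\ iter n f s <= w <= iter n f t.
    rewrite !lt_min !ltr_norml => /andP[/andP[/andP[? ?] /andP[? ?]]].
    move=> /andP[/andP[? ?] /andP[? ?]].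
    by split; apply/andP; split; lra.
  have [k [u [uc ku]]] := Lfuture d d0 (fun w wd => (dP w wd).1) x Lx.
  have [v /andP[sv vt] vu] := ivt u (dP u uc).2.
  exists (n + k)%N, v; split.
  - by rewrite (leq_trans Nn)// leq_addr.
  - by apply: npreim_iter; [exact: fB|apply: st_defined; rewrite sv|rewrite vu].
  - have x'v := le_trans x's sv; have vy' := le_trans vt ty'.
    by rewrite ler_norml; apply/andP; split; lra.
apply/seteqP; split=> y.
  move=> [n [u [_ un uy]]].
  rewrite /= in_itv/=; apply/andP; split.
    apply: (cvgr_to_ge uy); apply: nearW => j.
    by have /andP[] := npreim_range fB x01 (un j).
  apply: (cvgr_to_le uy); apply: nearW => j.
  by have /andP[] := npreim_range fB x01 (un j).
rewrite /= in_itv/= => y01.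
have H j : exists nu : nat * R, [/\ (j <= nu.1)%N, npreim c f nu.1 x nu.2 &
    `|nu.2 - y| <= j.+1%:R^-1].
  have [|n [u [jn nu uy]]] := approx y j.+1%:R^-1 j y01; first by rewrite invr_gt0.
  by exists (n, u).
have [nu nuP] := choice H.
exists (fun j => (nu j).1), (fun j => (nu j).2); split.
- apply/cvgnyPge => A; near=> j; have [+ _ _] := nuP j; apply: leq_trans.
  by near: j; exact: nbhs_infty_ge.
- by move=> j; have [] := nuP j.
- apply/cvgrPdist_le => e e0; near=> j; have [_ _] := nuP j.
  rewrite distrC => /le_trans; apply; apply: ltW; near: j.
  exact: (near_infty_natSinv_lt (PosNum e0)).
Unshelve. all: by end_near. Qed.

End main.

Theorem theorem3 (R : realType) (c : R) (f : R -> R) (Lambda : set R)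
  (f_lorenz : lorenz_map c f)
  (f_contracting : contracting c f)
  (f_non_flat : non_flat c f)
  (f_no_periodic_attractor : ~ exists A : set R, periodic_attractor c f A)
  (Lambda_attractor : topological_attractor c f Lambda)
  (Lambda_transitive : transitive_set c f Lambda)
  (Lambda_basin : residual_in `[0, 1] (basin c f Lambda)) :
  (~ exists I : set R, wandering_interval c f I) <->
  (forall x : R, Lambda x -> alpha_limit c f x = `[0, 1]%classic).
Proof.
have fB := lorenz_increasing_branches f_lorenz f_non_flat.
split=> [nW|]; last first.
  apply: alpha_limit_all_no_wandering => //.
  by have [t Lt _] := Lambda_transitive; exists t.
have dense_c : forall x y, 0 <= x -> x < y -> y <= 1 ->
    exists2 z, x < z < y & neg_orbit c f c z.
  move=> x y.
  exact: density_of_preimages fB _ _ nW f_no_periodic_attractor f_contracting.2.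
apply: no_wandering_alpha_limit_all => //; first by case: Lambda_attractor.
by move=> d d0 d01; exact: attractor_future.
Qed.
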